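(* Let $\mathbb{P}_N$ ($N\ge N_0=\max(2,\theta^{-1}\xi^{-1})$) be the probability measures on $\mathbb{W}^{\theta,\infty}_N$ described in the context, and suppose that there exists $R_0>0$ such that $r_N\le R_0N^{-3/4}$ for all $N$. Then for any $A>0$ there exist constants $D_1>0$ and $C>0$, both depending only on $R_0,A$ and $V,\theta,\xi,B_0,F_1,F_2$, such that for all $N\ge N_0$ $$\mathbb{P}_N(\ell_1\ge D_1N)\le e^{-AN+C}.$$
   Context: State space and measures. For $\theta>0$ and $N\in\mathbb{N}$ let $\mathbb{W}^{\theta,\infty}_N$ be the set of $(\ell_1,\dots,\ell_N)$ with $\ell_i=\lambda_i+(N-i)\theta$, where $\lambda_1\ge\cdots\ge\lambda_N\ge0$ are integers. Put $Q_\theta(x)=\frac{\Gamma(x+1)\Gamma(x+\theta)}{\Gamma(x)\Gamma(x+1-\theta)}$ and $$\mathbb{P}_N(\vec\ell)=\frac1{Z_N}\prod_{1\le i<j\le N}Q_\theta(\ell_i-\ell_j)\prod_{i=1}^N\exp(-NV_N(\ell_i/N)),\qquad\vec\ell\in\mathbb{W}^{\theta,\infty}_N,$$ with $Z_N$ the normalization constant. Assumptions. $\theta,\xi,B_0>0$ and increasing functions $F_1,F_2:(0,\infty)\to(0,\infty)$ are given. For each $N$, $V_N$ is continuous on $[0,\infty)$ and $V_N(t)\ge(1+\xi)\theta\log(1+t^2)$ for $t\ge0$. There are a continuous function $V$ on $[0,\infty)$ and a sequence $r_N\to0$ with $\sup_{x\in[0,a]}|V_N(x)-V(x)|\le F_1(a)\,r_N$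 for all $a>0$, $N\in\mathbb{N}$. $V$ is differentiable on $(0,\infty)$ and $|V'(x)|\le B_0(F_2(a)+|\log x|)$ for all $a>0$ and $x\in(0,a]$. *)

(* Defs.v *)
From HB Require Import structures.
From mathcomp Require Export all_boot all_order all_algebra.
From mathcomp Require Export all_classical all_reals all_analysis.
Export Order.TTheory GRing.Theory Num.Theory.
Export numFieldNormedType.Exports.

Set Implicit Arguments.
Unset Strict Implicit.
Unset Printing Implicit Defensive.

Local Open Scope classical_set_scope.
Local Open Scope ring_scope.

(* Meaningful for 0 < x only: for x <= 0 the integral diverges and Rintegral
   returns 0. *)
Definition Gamma (R : realType) (x : R) : R :=
  (\int[lebesgue_measure]_(t in `]0, +oo[) (t `^ (x - 1) * expR (- t)))%R.

Definition Qtheta (R : realType) (theta x : R) : R :=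
  (Gamma (x + 1) * Gamma (x + theta)) / (Gamma x * Gamma (x + 1 - theta)).

(* Coordinates are numbered from 0: tnth l i is l_{i+1}, hence the N - i.+1.
   All gaps l_i - l_j with i < j are >= theta, so that Qtheta theta is only
   evaluated where every argument of Gamma is positive. *)
Definition Wset (R : realType) (theta : R) (N : nat) : set (N.-tuple R) :=
  [set l | exists lam : 'I_N -> nat,
     (forall i j : 'I_N, (i <= j)%N -> (lam j <= lam i)%N) /\
     (forall i : 'I_N, tnth l i = (lam i)%:R + (N - i.+1)%:R * theta)].
Arguments Wset {R} theta N.

Definition gibbs_weight (R : realType) (theta : R) (N : nat) (VN : R -> R)
    (l : N.-tuple R) : R :=
  (\prod_(i < N) \prod_(j < N | (i < j)%N) Qtheta theta (tnth l i - tnth l j)) *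
  \prod_(i < N) expR (- (N%:R * VN (tnth l i / N%:R))).

Lemma Gamma_ge0 (R : realType) (x : R) : 0 <= Gamma x.
Proof. by apply: Rintegral_ge0 => t _; rewrite mulr_ge0 ?powR_ge0 ?expR_ge0. Qed.

Lemma gibbs_weight_ge0 (R : realType) (theta : R) (N : nat) (VN : R -> R)
    (l : N.-tuple R) : 0 <= gibbs_weight theta VN l.
Proof.
apply: mulr_ge0; apply: prodr_ge0 => i _; last exact: expR_ge0.
by apply: prodr_ge0 => j _; rewrite divr_ge0// mulr_ge0 ?Gamma_ge0.
Qed.

Section gibbs_mass.
Context (R : realType) (theta : R) (N : nat) (VN : R -> R).
Local Open Scope ereal_scope.

Definition gibbs_mass (E : set (N.-tuple R)) : \bar R :=
  \esum_(l in E `&` Wset theta N) (gibbs_weight theta VN l)%:E.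

Let gibbs_mass0 : gibbs_mass set0 = 0.
Proof. by rewrite /gibbs_mass set0I esum_set0. Qed.

Let gibbs_mass_ge0 E : 0 <= gibbs_mass E.
Proof. by apply: esum_ge0 => l _; rewrite lee_fin gibbs_weight_ge0. Qed.

Let gibbs_mass_sigma_additive : semi_sigma_additive gibbs_mass.
Proof.
move=> F _ tF _; rewrite /gibbs_mass setI_bigcupl nneseries_sum_bigcup; last 2 first.
- by apply: trivIset_setIr.
- by move=> l; rewrite lee_fin gibbs_weight_ge0.
by apply: is_cvg_nneseries => n _ _; exact: gibbs_mass_ge0.
Qed.

HB.instance Definition _ := isMeasure.Build _ _ _ gibbs_mass
  gibbs_mass0 gibbs_mass_ge0 gibbs_mass_sigma_additive.

End gibbs_mass.
Arguments gibbs_mass {R} theta N VN E.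

(* The value at E is gibbs_mass E / Z_N with Z_N = gibbs_mass setT; the Dirac
   mass is only the default value mnormalize uses when Z_N is 0 or +oo. *)
Definition gibbs (R : realType) (theta : R) (N : nat) (VN : R -> R) :
    probability (N.-tuple R) R :=
  mnormalize (gibbs_mass theta N VN) (dirac [tuple of nseq N (0 : R)]).
Arguments gibbs {R} theta N VN.

(* Main.v *)
Require Import Defs.
From mathcomp Require Import all_boot all_order all_algebra ring lra zify.
From mathcomp Require Import all_classical all_reals all_analysis.
From mathcomp Require Import measurable_realfun.
Import Order.TTheory GRing.Theory Num.Theory.
Import numFieldNormedType.Exports.

Set Implicit Arguments.
Unset Strict Implicit.
Unset Printing Implicit Defensive.

Local Open Scope classical_set_scope.
Local Open Scope ring_scope.

(**
A configuration whose partition is [lam] has weight [exp (energy lam)], where the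
energy is the sum of [ln (Qtheta theta (l_i - l_j))] over the pairs minus the total
potential.  The normalization Z is never estimated: each configuration whose first
particle lies beyond D N is compared with one other configuration.  [downhill]
provides, for N large, a nonincreasing [lam'] with
  energy lam + A N + penalty lam <= energy lam',
where [penalty lam] adds up ln ((m + 1) (m + 2)) over the successive differences m
of [lam].  These differences determine [lam], and the numbers 1 / ((m + 1) (m + 2))
have sum at most one, so that exp (- penalty) has total mass at most one
([penalty_sum_le1]).  As a single weight is at most Z, the mass of the event is at
most exp (- A N) Z ([gibbs_tail_le]), although many [lam] may share the same [lam'].

Two facts on the energy are used.  The functional equation and the log-convexity of
Gamma give ln (Qtheta theta x) = 2 theta ln x + O(1 / x) for x >= theta
([ln_Qtheta]): the particles repel logarithmically, while the potential
V_N (x) >= 2 (1 + xi) theta ln x (for x >= 1) wins over this repulsion by a factor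
1 + xi.  And the bound on V' makes V a Lipschitz function of the square root of x on
bounded intervals ([sqrt_lipschitz]), so that particles near the hard edge 0 may be
moved at small cost.

Let nu = N^(1/20), and let k be the number of particles beyond T0 N.

If k >= nu^8 ([thick_tail]), the k outermost particles are removed, the others are
pushed outwards a little and k particles are packed at the bottom ([refill]).  The
removed particles x_i N bring a gain 2 xi theta N (sum of the ln x_i), which is at
least 2 xi theta ln T0 times k N.  The costs of order k N have a constant that does
not depend on T0, and the other costs are at most of order N^(5/4) = nu^25, the price
of replacing V_N by V; they are small compared with k N >= nu^28.  A large T0
therefore suffices.

If k < nu^8 ([thin_tail]), let T1 minimize V(t) - 2 theta ln (t - T0) beyond T0
([best_shelf]).  All particles beyond T1 N are moved down to just above T1 N
([shelve]).  The repulsion that such a particle feels from the bulk below T0 N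
decreases by at most what the logarithm in this formula says, so that up to an error
of order nu^9 no move loses energy.  The errors add up to o(N), whereas the first
particle, when it comes from beyond D N, gains any prescribed multiple of N.
*)

(** * The Gamma function *)

Section GammaIntegrand.
Context {R : realType}.
Implicit Types (x t : R).
Local Notation mu := (@lebesgue_measure R).

Definition gint x t : R := t `^ (x - 1) * expR (- t).

Lemma gint_ge0 x t : 0 <= gint x t.
Proof. by rewrite mulr_ge0 ?powR_ge0 ?expR_ge0. Qed.

Lemma measurable_gint x (D : set R) : measurable_fun D (gint x).
Proof.
apply: measurable_funTS; apply: measurable_funM.
  exact: (measurable_powR (x - 1)).
by apply: measurableT_comp.
Qed.

Lemma is_derive_gint x t : 0 < t ->
  is_derive t 1 (gint (x + 1)) (x * gint x t - gint (x + 1) t).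
Proof.
move=> t0.
have -> : gint (x + 1) = (fun t => t `^ x) * (fun t => expR (- t)).
  by apply/funext => s; rewrite /gint addrK.
have h1 := is_derive1_powR x t0.
have h2 : is_derive t 1 (fun t : R => expR (- t)) (- expR (- t)).
  have := @is_derive1_comp R expR (fun t => - t) t (expR (- t)) (-1).
  move=> /(_ (is_derive_expR _) (is_deriveNid _ _)).
  by rewrite mulrN1.
apply: is_derive_eq.
have -> : ((powR (R:=R))^~ x * (fun t1 => expR (- t1))) t = t `^ x * expR (- t) by [].
by rewrite /gint /GRing.scale/=; ring.
Qed.

Lemma gint_cont x (a b : R) : 0 < a -> {within `[a, b], continuous (gint x)}.
Proof.
move=> a0; apply: derivable_within_continuous => t; rewrite in_itv/= => /andP[at_ _].
rewrite -(subrK 1 x); have := @is_derive_gint (x - 1) t (lt_le_trans a0 at_).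
by case.
Qed.

Lemma gint_integrable_cc x (a b : R) : 0 < a ->
  mu.-integrable `[a, b] (EFin \o gint x).
Proof.
move=> a0; apply: continuous_compact_integrable; first exact: segment_compact.
exact: gint_cont.
Qed.

Lemma gint_ibp x (a b : R) : 0 < a -> a < b ->
  x * \int[mu]_(t in `[a, b]) gint x t =
  \int[mu]_(t in `[a, b]) gint (x + 1) t + gint (x + 1) b - gint (x + 1) a.
Proof.
move=> a0 ab.
have H : gint (x + 1) b - gint (x + 1) a = \int[mu]_(t in `[a, b]) (x * gint x t - gint (x + 1) t).
  rewrite /Rintegral (@continuous_FTC2 R _ (gint (x + 1)))//.
  - apply: derivable_within_continuous => t; rewrite in_itv/= => /andP[at_ _].
    have t0 := lt_le_trans a0 at_.
    have [d1 _] := @is_derive_gint x t t0.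
    have := @is_derive_gint (x - 1) t t0; rewrite subrK => -[d2 _].
    apply: (@derivableB _ _ _ (fun t => x * gint x t)); last exact: d1.
    by apply: (@derivableM _ _ (cst x)); [exact: derivable_cst|exact: d2].
  - have /continuous_within_itvP : {within `[a, b], continuous (gint (x + 1))} by exact: gint_cont.
    move=> /(_ ab) [_ h1 h2]; split => // t.
    rewrite in_itv/= => /andP[at_ _].
    by have [] := @is_derive_gint x t (lt_trans a0 at_).
  - move=> t; rewrite in_itv/= => /andP[at_ _].
    by rewrite derive1E; have [_ ->] := @is_derive_gint x t (lt_trans a0 at_).
rewrite -addrA H RintegralB//=; last 2 first.
- exact: (@integrableZl _ _ _ mu `[a, b] _ x _ (gint_integrable_cc x b a0)).
- exact: gint_integrable_cc.
rewrite RintegralZl//=; last exact: gint_integrable_cc.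
by rewrite addrC subrK.
Qed.

(** Compact intervals that avoid both ends of the half-line, where the integrand may be
    singular. *)
Definition exhaust (n : nat) : set R := `[n.+1%:R^-1, n.+1%:R].

Lemma exhaust_bigcup : \bigcup_n exhaust n = `]0, +oo[%classic.
Proof.
apply/seteqP; split => [t [n _]|t]; rewrite /exhaust /= !in_itv/=.
  by move=> /andP[nt _]; rewrite andbT (lt_le_trans _ nt)// invr_gt0.
rewrite andbT => t0.
have [m [m1 m2]] : exists m : nat, t <= m%:R /\ t^-1 <= m%:R.
  exists (maxn (Num.truncn t).+1 (Num.truncn t^-1).+1).
  split; apply: ltW.
    by apply: (lt_le_trans (truncnS_gt t)); rewrite ler_nat leq_maxl.
  by apply: (lt_le_trans (truncnS_gt t^-1)); rewrite ler_nat leq_maxr.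
exists m => //=; rewrite in_itv/=; apply/andP; split.
  rewrite -[leRHS]invrK lef_pV2 ?posrE ?invr_gt0//.
  by rewrite (le_trans m2)// ler_nat.
by rewrite (le_trans m1)// ler_nat.
Qed.

Lemma exhaust_homo : {homo exhaust : n m / (n <= m)%N >-> (n <= m)%O}.
Proof.
move=> n m nm; apply/subsetPset => t; rewrite /exhaust /= !in_itv/= => /andP[a b].
apply/andP; split.
  by rewrite (le_trans _ a)// lef_pV2 ?posrE ?ltr0n// ler_nat.
by rewrite (le_trans b)// ler_nat.
Qed.

Lemma gint_exhaust_cvg x :
  (\int[mu]_(t in exhaust n) (gint x t)%:E)%E @[n --> \oo] -->
  (\int[mu]_(t in `]0%R, +oo[) (gint x t)%:E)%E.
Proof.
rewrite -exhaust_bigcup; apply: ge0_nondecreasing_set_cvg_integral.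
- exact: exhaust_homo.
- by move=> i; exact: measurable_itv.
- by move=> i; apply/measurable_EFinP; exact: measurable_gint.
- by move=> i t _; rewrite lee_fin gint_ge0.
Qed.

(** The tangent of [ln] at 2 x - 1 trades the power of t for half of the exponential
    decay. *)
Lemma gint_le_expR x t : 1 <= x -> 0 < t ->
  gint x t <= (2 * x - 1) `^ (x - 1) * expR (- (2^-1 * t)).
Proof.
move=> x1 t0; rewrite /gint /powR gt_eqF// gt_eqF; last lra.
rewrite -!expRD ler_expR.
have := @le_ln1Dx R (t / (2 * x - 1) - 1).
have c0 : 0 < 2 * x - 1 by lra.
have -> : 1 + (t / (2 * x - 1) - 1) = t / (2 * x - 1) by rewrite addrC subrK.
rewrite lnM ?posrE ?invr_gt0// lnV ?posrE//.
have : 0 < t / (2 * x - 1) by rewrite divr_gt0.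
set u := t / (2 * x - 1) => u0 /(_ ltac:(lra)) h.
have tE : t = u * (2 * x - 1) by rewrite /u divfK ?gt_eqF.
have : (x - 1) * (ln t - ln (2 * x - 1)) <= (x - 1) * (u - 1) by rewrite ler_wpM2l//; lra.
rewrite [in - t]tE [in 2^-1 * t]tE; nra.
Qed.

Lemma gint_integrable1 x : 1 <= x -> mu.-integrable `]0, +oo[ (EFin \o gint x).
Proof.
move=> x1; pose c := (2 * x - 1) `^ (x - 1).
apply: (@le_integrable _ _ _ mu `]0, +oo[%classic _ _ (fun t => ((2 * c)%:E * (exponential_pdf
    (2^-1) t)%:E)%E)) => //.
- by apply/measurable_EFinP; exact: measurable_gint.
- move=> t /=; rewrite in_itv/= andbT => t0.
  rewrite exponential_pdfE; last exact: ltW.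
  rewrite lee_fin ger0_norm ?gint_ge0//.
  apply: le_trans (gint_le_expR x1 t0) _.
  rewrite ger0_norm; last by rewrite !mulr_ge0 ?powR_ge0 ?expR_ge0// invr_ge0.
  by rewrite mulNr mulrA [2 * c]mulrC mulfK.
- apply: (@integrableZl _ _ _ mu `]0, +oo[ _ (2 * c) (EFin \o exponential_pdf 2^-1)) => //.
  apply: integrableS (integrable_exponential_pdf _) => //.
Qed.

Lemma gint_bounded x : 0 < x -> exists C, forall t, 0 < t -> gint (x + 1) t <= C.
Proof.
move=> x0; exists ((2 * (x + 1) - 1) `^ (x + 1 - 1)) => t t0.
apply: le_trans (gint_le_expR _ t0) _; first lra.
by rewrite ler_piMr ?powR_ge0// -expR0 ler_expR oppr_le0 mulr_ge0// ltW.
Qed.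

Lemma gint_cvg0_y x : 0 < x -> gint (x + 1) n.+1%:R @[n --> \oo] --> 0.
Proof.
move=> x0; set c := (2 * (x + 1) - 1) `^ (x + 1 - 1).
apply: (@squeeze_cvgr _ \oo _ _ (fun=> 0) (fun n => c * expR (- (2^-1 * n.+1%:R)))).
- near=> n; rewrite gint_ge0/=; apply: gint_le_expR; rewrite ?ltr0n//; lra.
- exact: cvg_cst.
- rewrite -[X in _ --> X](mulr0 c); apply: cvgM; first exact: cvg_cst.
  have h : (fun n : nat => 2^-1 * n.+1%:R : R) @ \oo --> +oo.
    have h0 : (fun n : nat => n.+1%:R : R) @ \oo --> +oo.
      by have := @cvgr_idn R; rewrite -(cvg_shiftS (fun n : nat => n%:R : R)).
    have h2 : (fun r : R => 2^-1 * r) @ +oo --> +oo.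
      by apply: gt0_cvgMry; [rewrite invr_gt0|exact: cvg_id].
    exact: (cvg_comp _ _ h0 h2).
  exact: (cvg_comp _ _ h (@cvgr_expR R)).
Unshelve. all: by end_near. Qed.

Lemma gint_cvg0_0 x : 0 < x -> gint (x + 1) n.+1%:R^-1 @[n --> \oo] --> 0.
Proof.
move=> x0.
apply: (@squeeze_cvgr _ \oo _ _ (fun=> 0) (fun n => n.+1%:R^-1 `^ x)).
- near=> n; rewrite gint_ge0/= /gint addrK ler_piMr ?powR_ge0//.
- exact: cvg_cst.
- have h : (fun n : nat => n.+1%:R^-1 : R) @ \oo --> 0^'+.
    move=> A /= hA; have := @cvg_harmonic R _ hA.
    move=> H; apply: (@filterS _ \oo _ (fun n => 0 < (n.+1%:R^-1 : R) -> A n.+1%:R^-1)) H.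
    by move=> n; apply; rewrite invr_gt0.
  exact: (cvg_comp _ _ h (powR_cvg0 x0)).
Unshelve. all: by end_near. Qed.

Lemma Rintegral_gint_le x (D : set R) : measurable D -> D `<=` `]0, +oo[ ->
  1 <= x -> \int[mu]_(t in D) gint x t <= \int[mu]_(t in `]0, +oo[) gint x t.
Proof.
move=> mD DS x1; have I1 := gint_integrable1 x1.
rewrite fine_le//.
- by apply: integrable_fin_num => //; apply: integrableS I1.
- exact: integrable_fin_num.
- apply: ge0_subset_integral => //.
  + by apply/measurable_EFinP; exact: measurable_gint.
  + by move=> t _; rewrite lee_fin gint_ge0.
Qed.

Lemma exhaust_sub n : exhaust n `<=` `]0, +oo[.
Proof. by rewrite -exhaust_bigcup; exact: bigcup_sup. Qed.

(** For exponents x >= 1 an exponential density dominates.  For smaller ones,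
    integration by parts bounds the integrals over the compact intervals [exhaust n] by
    the integral with exponent x + 1. *)
Lemma gint_integrable x : 0 < x -> mu.-integrable `]0, +oo[ (EFin \o gint x).
Proof.
move=> x0; apply/integrableP; split.
  by apply/measurable_EFinP; exact: measurable_gint.
under eq_integral do rewrite /= ger0_norm ?gint_ge0//.
have x1 : 1 <= x + 1 by lra.
have [C hC] := gint_bounded x0.
pose J := \int[mu]_(t in `]0, +oo[) gint (x + 1) t.
apply: (@le_lt_trans _ _ ((J + C) / x)%:E); last exact: ltry.
apply: (cvge_le _ (gint_exhaust_cvg (x := x))).
near=> n.
have n1 : (n.+1%:R^-1 : R) < n.+1%:R.
  rewrite (@lt_trans _ _ 1)// ?invf_lt1 ?ltr1n//; by near: n; exists 1%N.
have := @gint_ibp x n.+1%:R^-1 n.+1%:R.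
rewrite invr_gt0 ltr0n => /(_ isT n1) E.
rewrite -[leLHS]fineK; last first.
  by apply: (integrable_fin_num _ (gint_integrable_cc _ _ _)) => //; exact: measurable_itv.
rewrite lee_fin ler_pdivlMr// mulrC.
rewrite -/(Rintegral _ _ _) /exhaust E.
have h1 := hC n.+1%:R (ltr0Sn _ _).
have h2 := gint_ge0 (x + 1) n.+1%:R^-1.
have := @Rintegral_gint_le (x + 1) (exhaust n) (measurable_itv _) (@exhaust_sub n) x1.
rewrite /exhaust -/J; lra.
Unshelve. all: by end_near. Qed.

Lemma Rintegral_exhaust_cvg x : 0 < x ->
  \int[mu]_(t in exhaust n) gint x t @[n --> \oo] --> Gamma x.
Proof.
move=> x0; apply: fine_cvg.
rewrite fineK; first exact: gint_exhaust_cvg.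
by apply: integrable_fin_num => //; exact: gint_integrable.
Qed.

(** Integration by parts on [exhaust n]; the boundary terms vanish in the limit. *)
Lemma GammaS x : 0 < x -> Gamma (x + 1) = x * Gamma x.
Proof.
move=> x0.
have x10 : 0 < x + 1 by lra.
pose u n := x * \int[mu]_(t in exhaust n) gint x t.
have h1 : u @ \oo --> x * Gamma x.
  by apply: cvgM; [exact: cvg_cst|exact: Rintegral_exhaust_cvg].
have h2 : u @ \oo --> Gamma (x + 1).
  have h := cvgB (cvgD (Rintegral_exhaust_cvg x10) (gint_cvg0_y x0)) (gint_cvg0_0 x0).
  rewrite addr0 subr0 in h.
  apply: cvg_trans (h _ _); apply: near_eq_cvg; near=> n.
  have n1 : (n.+1%:R^-1 : R) < n.+1%:R.
    rewrite (@lt_trans _ _ 1)// ?invf_lt1 ?ltr1n//; by near: n; exists 1%N.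
  have := @gint_ibp x n.+1%:R^-1 n.+1%:R.
  by rewrite invr_gt0 ltr0n => /(_ isT n1) /esym.
by rewrite -(cvg_lim (@Rhausdorff R) h1) -(cvg_lim (@Rhausdorff R) h2).
Unshelve. all: by end_near. Qed.

Lemma Gamma_gt0 x : 0 < x -> 0 < Gamma x.
Proof.
move=> x0; have I := gint_integrable x0.
pose c : R := 2^-1 * expR (- 2).
have c0 : 0 < c by rewrite mulr_gt0 ?expR_gt0 ?invr_gt0.
apply: (lt_le_trans c0).
rewrite -lee_fin /Gamma /Rintegral fineK; last exact: integrable_fin_num.
apply: (@le_trans _ _ (\int[mu]_(t in `[1%R, 2%R]) c%:E)%E).
  rewrite integral_cst//= lebesgue_measure_itv/= lte_fin ltr1n/= -EFinB -EFinM.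
  by rewrite lee_fin (_ : 2 - 1 = 1) ?mulr1//; ring.
apply: (@le_trans _ _ (\int[mu]_(t in `[1%R, 2%R]) (gint x t)%:E)%E).
  apply: ge0_le_integral => //.
  - by move=> t _; rewrite lee_fin ltW.
  - by apply/measurable_EFinP; exact: measurable_gint.
  - move=> t /=; rewrite in_itv/= => /andP[t1 t2]; rewrite lee_fin /c /gint.
    rewrite ler_pM ?invr_ge0 ?expR_ge0//; last by rewrite ler_expR lerN2.
    apply: (@le_trans _ _ (t `^ (-1))).
      rewrite powR_inv1; last lra.
      by rewrite lef_pV2 ?posrE//; lra.
    by apply: ler_powR => //; lra.
apply: ge0_subset_integral => //.
- by apply/measurable_EFinP; exact: measurable_gint.
- by move=> t _; rewrite lee_fin gint_ge0.
- by move=> t; rewrite /= !in_itv/= => /andP[t1 _]; rewrite andbT; lra.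
Qed.

Lemma expR_convex2 (u v s : R) : 0 <= s <= 1 ->
  expR (s * u + (1 - s) * v) <= s * expR u + (1 - s) * expR v.
Proof.
move=> /andP[s0 s1]; set m := s * u + (1 - s) * v.
have h w : expR m * (1 + (w - m)) <= expR w.
  have -> : expR w = expR m * expR (w - m) by rewrite -expRD addrC subrK.
  rewrite ler_wpM2l ?expR_ge0//.
  exact: expR_ge1Dx.
have -> : expR m = s * (expR m * (1 + (u - m))) + (1 - s) * (expR m * (1 + (v - m))).
  rewrite /m; ring.
by apply: lerD; rewrite ler_wpM2l ?subr_ge0.
Qed.

Lemma expR_convex2_shift (u v U W s : R) : 0 <= s <= 1 ->
  expR (s * u + (1 - s) * v) <=
  expR (s * U + (1 - s) * W) * (s * (expR u / expR U) + (1 - s) * (expR v / expR W)).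
Proof.
move=> s01; rewrite -!expRN -!expRD.
have := @expR_convex2 (u - U) (v - W) s s01.
rewrite -(ler_pM2l (expR_gt0 (s * U + (1 - s) * W))) -expRD; apply: le_trans.
by rewrite ler_expR le_eqVlt; apply/orP; left; apply/eqP; ring.
Qed.

(** The pointwise inequality behind Hoelder's: the weights 1 / p and 1 / q are there to be
    specialized to the inverses of the two integrals. *)
Lemma expR_AMGM (u v p q s : R) : 0 <= s <= 1 -> 0 < p -> 0 < q ->
  expR (s * u + (1 - s) * v) <=
  expR (s * ln p + (1 - s) * ln q) * (s / p) * expR u +
  expR (s * ln p + (1 - s) * ln q) * ((1 - s) / q) * expR v.
Proof.
move=> s01 p0 q0; have := @expR_convex2_shift u v (ln p) (ln q) s s01.
rewrite (lnK p0) (lnK q0) => /le_trans; apply.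
by rewrite le_eqVlt; apply/orP; left; apply/eqP; ring.
Qed.

Lemma gintE x t : 0 < t -> gint x t = expR ((x - 1) * ln t - t).
Proof. by move=> t0; rewrite /gint /powR gt_eqF// -expRD. Qed.

Lemma GammaE x : \int[mu]_(t in `]0, +oo[) gint x t = Gamma x.
Proof. by []. Qed.

(** Integrating [expR_AMGM] with p = Gamma x and q = Gamma y makes the right-hand side
    exactly the geometric mean. *)
Lemma Gamma_logconvex x y s : 0 < x -> 0 < y -> 0 <= s <= 1 ->
  0 < s * x + (1 - s) * y ->
  ln (Gamma (s * x + (1 - s) * y)) <= s * ln (Gamma x) + (1 - s) * ln (Gamma y).
Proof.
move=> x0 y0 s01; have /andP[s0 s1] := s01.
set z := s * x + _ => z0.
have Gx := Gamma_gt0 x0; have Gy := Gamma_gt0 y0; have Gz := Gamma_gt0 z0.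
set m := s * ln _ + _.
rewrite -ler_expR lnK ?posrE//.
set a := expR m * (s / Gamma x); set b := expR m * ((1 - s) / Gamma y).
pose f t := a * gint x t + b * gint y t.
have Ia : mu.-integrable `]0, +oo[ (EFin \o (fun t => a * gint x t)).
  exact: (@integrableZl _ _ _ mu `]0, +oo[%classic _ a _ (gint_integrable x0)).
have Ib : mu.-integrable `]0, +oo[ (EFin \o (fun t => b * gint y t)).
  exact: (@integrableZl _ _ _ mu `]0, +oo[%classic _ b _ (gint_integrable y0)).
have If : mu.-integrable `]0, +oo[ (EFin \o f).
  exact: (@integrableD _ _ _ mu `]0, +oo[%classic _ _ _ Ia Ib).
have -> : expR m = \int[mu]_(t in `]0, +oo[) f t.
  rewrite (RintegralD _ Ia Ib)// (RintegralZl _ _ (gint_integrable x0))//.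
  rewrite (RintegralZl _ _ (gint_integrable y0))//.
  rewrite !GammaE /a /b.
  have E (e p q : R) : 0 < p -> 0 < q -> e = e * (s / p) * p + e * ((1 - s) / q) * q.
    by move=> p0 q0; rewrite -!mulrA !mulVf ?gt_eqF// !mulr1 -mulrDr addrC subrK mulr1.
  exact: E.
apply: le_Rintegral => //; first exact: gint_integrable.
move=> t /=; rewrite in_itv/= andbT => t0.
have zE : (z - 1) * ln t - t =
    s * ((x - 1) * ln t - t) + (1 - s) * ((y - 1) * ln t - t).
  by rewrite /z; ring.
suff h : gint z t <= a * gint x t + b * gint y t by exact: h.
rewrite !gintE// zE; exact: expR_AMGM.
Qed.

End GammaIntegrand.

(** * Elementary inequalities *)

Lemma ln_sub_le (R : realType) (p q : R) : 0 < p -> 0 < q -> ln p - ln q <= (p - q) / q.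
Proof.
move=> p0 q0; have := @le_ln1Dx R (p / q - 1).
have -> : 1 + (p / q - 1) = p / q by ring.
have pq : 0 < p / q by rewrite divr_gt0.
rewrite ln_div ?posrE// => /(_ ltac:(lra)) /le_trans; apply.
by rewrite mulrBl divff ?gt_eqF.
Qed.

Lemma exchange_pairs (R : realType) (F : nat -> nat -> R) n :
  \sum_(0 <= j < n) \sum_(0 <= i < j) F i j = \sum_(0 <= i < n) \sum_(i.+1 <= j < n) F i j.
Proof.
elim: n => [|n IH]; first by rewrite !big_geq.
rewrite big_nat_recr//= IH [RHS]big_nat_recr//= (@big_geq _ _ _ n.+1 n.+1)// addr0.
rewrite -big_split/=; apply: eq_big_nat => i /andP[_ ni].
by rewrite [RHS]big_nat_recr.
Qed.

Lemma sum_const_le (R : realType) (F : nat -> R) (c : R) m n : (m <= n)%N ->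
  (forall i, (m <= i < n)%N -> F i <= c) -> \sum_(m <= i < n) F i <= (n - m)%:R * c.
Proof.
move=> mn h; apply: (@le_trans _ _ (\sum_(m <= i < n) c)).
  by apply: ler_sum_nat.
by rewrite sumr_const_nat mulr_natl.
Qed.

Lemma harmonic_le (R : realType) n : (0 < n)%N ->
  \sum_(1 <= d < n.+1) d%:R^-1 <= 1 + ln n%:R :> R.
Proof.
case: n => // n _; elim: n => [|n IH].
  by rewrite big_nat1 ln1 addr0 invr1.
rewrite big_nat_recr//=; apply: le_trans (lerD IH (lexx _)) _.
rewrite -addrA lerD2l.
have := @ln_sub_le R n.+1%:R n.+2%:R; rewrite !ltr0n => /(_ isT isT).
have -> : (n.+1%:R - n.+2%:R) / n.+2%:R = - n.+2%:R^-1 :> R.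
  by rewrite -[n.+2%:R]natr1 opprD addrA subrr add0r mulN1r.
move: (ln n.+1%:R) (ln n.+2%:R) (n.+2%:R^-1) => x y z; lra.
Qed.

(** N^j / j! is one term of the exponential series at N. *)
Lemma ln_fact_ge (R : realType) j N : (0 < N)%N ->
  j%:R * ln N%:R - N%:R <= ln (j`!%:R : R).
Proof.
move=> N0; have N0' : 0 < (N%:R : R) by rewrite ltr0n.
have f0 : 0 < (j`!%:R : R) by rewrite ltr0n fact_gt0.
have h : N%:R ^+ j <= expR N%:R * j`!%:R :> R.
  case: j f0 => [|j] f0.
    by rewrite expr0 mulr1 -[leLHS](@expR0 R) ler_expR.
  rewrite -ler_pdivrMr//.
  apply: le_trans (expR_ge1Dxn j (ltW N0')); by rewrite lerDr.
have := h; rewrite -ler_ln ?posrE ?mulr_gt0 ?exprn_gt0 ?expR_gt0//.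
by rewrite lnXn// lnM ?posrE ?expR_gt0// expRK mulr_natl lerBlDl.
Qed.

Lemma sum_inv_sqrt_le (R : realType) n :
  \sum_(0 <= m < n) (Num.sqrt (m.+1%:R : R))^-1 <= 2 * Num.sqrt (n%:R : R).
Proof.
elim: n => [|n IH]; first by rewrite big_geq// sqrtr0 mulr0.
rewrite big_nat_recr//=; apply: le_trans (lerD IH (lexx _)) _.
have a2 : Num.sqrt (n%:R : R) ^+ 2 = n%:R by rewrite sqr_sqrtr.
have b2 : Num.sqrt (n.+1%:R : R) ^+ 2 = n%:R + 1 by rewrite sqr_sqrtr// natr1.
have a0 : 0 <= Num.sqrt (n%:R : R) by exact: sqrtr_ge0.
have b0 : 0 < Num.sqrt (n.+1%:R : R) by rewrite sqrtr_gt0.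
set a := Num.sqrt n%:R in a2 a0 *; set b := Num.sqrt n.+1%:R in b2 b0 *.
rewrite -(ler_pM2r b0) mulrDl mulVf ?gt_eqF//.
nra.
Qed.

Lemma sum_ln_fact (R : realType) j : \sum_(0 <= i < j) ln ((j - i)%:R : R) = ln (j`!%:R).
Proof.
elim: j => [|j IH]; first by rewrite big_geq// fact0 ln1.
rewrite big_nat_recl// subn0 factS natrM lnM ?posrE ?ltr0n ?fact_gt0//.
by rewrite -IH; congr (_ + _); apply: eq_big_nat => i _; rewrite subSS.
Qed.

Lemma sum_nat_top (R : realType) (G : nat -> R) k N : (k <= N)%N ->
  \sum_(N - k <= j < N) G j = \sum_(0 <= a < k) G (N - a.+1)%N.
Proof.
move=> kN; rewrite [RHS]big_nat_rev/= add0n -{1}[(N - k)%N]add0n big_addn subKn//.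
by apply: eq_big_nat => i /andP[_ ik]; congr G; lia.
Qed.

Lemma sqrtrB_le (R : realType) (x y : R) : 0 < x -> x <= y ->
  Num.sqrt y - Num.sqrt x <= (y - x) / Num.sqrt x.
Proof.
move=> x0 xy.
have a0 : 0 < Num.sqrt x by rewrite sqrtr_gt0.
have a2 : Num.sqrt x ^+ 2 = x by rewrite sqr_sqrtr// ltW.
have b2 : Num.sqrt y ^+ 2 = y by rewrite sqr_sqrtr//; lra.
have ab : Num.sqrt x <= Num.sqrt y by rewrite ler_wsqrtr.
rewrite ler_pdivlMr// -[in leRHS]a2 -[in leRHS]b2.
have : 0 <= (Num.sqrt y - Num.sqrt x) * Num.sqrt y.
  by rewrite mulr_ge0 ?subr_ge0// sqrtr_ge0.
move: (Num.sqrt x) (Num.sqrt y) => a b; lra.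
Qed.

Lemma sqrtrB_le_top (R : realType) (x y : R) : 0 <= x -> x <= y -> 0 < y ->
  Num.sqrt y - Num.sqrt x <= (y - x) / Num.sqrt y.
Proof.
move=> x0 xy y0.
have a0 : 0 < Num.sqrt y by rewrite sqrtr_gt0.
have a2 : Num.sqrt x ^+ 2 = x by rewrite sqr_sqrtr.
have b2 : Num.sqrt y ^+ 2 = y by rewrite sqr_sqrtr// ltW.
have ab : Num.sqrt x <= Num.sqrt y by rewrite ler_wsqrtr.
rewrite ler_pdivlMr// -[in leRHS]a2 -[in leRHS]b2.
have : 0 <= (Num.sqrt y - Num.sqrt x) * Num.sqrt x.
  by rewrite mulr_ge0 ?subr_ge0// sqrtr_ge0.
move: (Num.sqrt x) (Num.sqrt y) => a b; lra.
Qed.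

(** * Logarithmic asymptotics of the interaction *)

Section Interaction.
Context {R : realType}.
Implicit Types (x y z u a : R).

(** Between x and x + c the derivative of [ln] is at most 1 / (kappa x). *)
Lemma ln_shift (kappa c x : R) : 0 < kappa -> kappa <= 1 -> 0 < x -> kappa * x <= x + c ->
  `|ln (x + c) - ln x| <= `|c| / kappa / x.
Proof.
move=> k0 k1 x0 kx.
have kx0 : 0 < kappa * x by rewrite mulr_gt0.
have xc0 : 0 < x + c by lra.
have u1 := ln_sub_le xc0 x0; have u2 := ln_sub_le x0 xc0.
rewrite ler_norml; apply/andP; split; last first.
  apply: (le_trans u1); rewrite addrAC subrr add0r ler_pM2r ?invr_gt0//.
  apply: (le_trans (ler_norm _)); rewrite ler_peMr// invf_ge1//.
rewrite lerNl opprB; apply: (le_trans u2).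
have -> : x - (x + c) = - c by ring.
apply: (@le_trans _ _ (`|c| / (x + c))).
  by rewrite ler_pM2r ?invr_gt0// -normrN ler_norm.
rewrite -mulrA -invfM ler_wpM2l// lef_pV2 ?posrE//.
Qed.

(** For a convex function with the functional equation of ln Gamma, the increment over
    [u, u + a] is squeezed between the slopes ln (u - 1) and ln (u + a) of
    the unit intervals before and after it. *)
Section LogConvex.
Variables (G : R -> R).
Hypothesis GS : forall x, 0 < x -> G (x + 1) = ln x + G x.
Hypothesis Gconv : forall x y s, 0 < x -> 0 < y -> 0 <= s <= 1 -> 0 < s * x + (1 - s) * y ->
  G (s * x + (1 - s) * y) <= s * G x + (1 - s) * G y.

Lemma logconvex_slope x y z : 0 < x -> x < y -> y < z ->
  (G y - G x) * (z - y) <= (G z - G y) * (y - x).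
Proof.
move=> x0 xy yz.
have zx : 0 < z - x by lra.
pose s := (z - y) / (z - x).
have s01 : 0 <= s <= 1.
  by rewrite /s divr_ge0 ?ler_pdivrMr ?mul1r//=; lra.
have yE : y = s * x + (1 - s) * z.
  by rewrite /s; field; rewrite gt_eqF.
have := @Gconv x z s x0 _ s01.
rewrite -yE => /(_ ltac:(lra) ltac:(lra)).
rewrite -(ler_pM2r zx).
have -> : (s * G x + (1 - s) * G z) * (z - x) = (z - y) * G x + (y - x) * G z.
  by rewrite /s; field; rewrite gt_eqF.
lra.
Qed.

Lemma logconvex_lower u a : 1 < u -> 0 <= a -> a * ln (u - 1) <= G (u + a) - G u.
Proof.
rewrite [0 <= _]le_eqVlt => u1 /orP[/eqP<-|a0]; first by rewrite mul0r addr0 subrr.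
have := @logconvex_slope (u - 1) u (u + a) ltac:(lra) ltac:(lra) ltac:(lra).
have := @GS (u - 1) ltac:(lra); rewrite subrK => ->.
have -> : u + a - u = a by ring.
have -> : u - (u - 1) = 1 by ring.
by rewrite mulr1 addrK mulrC.
Qed.

Lemma logconvex_upper u a : 0 < u -> 0 <= a -> G (u + a) - G u <= a * ln (u + a).
Proof.
rewrite [0 <= _]le_eqVlt => u1 /orP[/eqP<-|a0]; first by rewrite mul0r addr0 subrr.
have := @logconvex_slope u (u + a) (u + a + 1) ltac:(lra) ltac:(lra) ltac:(lra).
rewrite GS; last lra.
have -> : u + a + 1 - (u + a) = 1 by ring.
have -> : u + a - u = a by ring.
by rewrite mulr1 addrK mulrC.
Qed.

(** G (x + 1) - G x is ln x exactly; what remains is the increment of G from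
    x + 1 - theta to x + theta, whose length 2 theta - 1 contributes (2 theta - 1) ln x. *)
Lemma logconvex_ratio (theta : R) : 0 < theta -> exists2 C : R, 0 < C &
  forall x, theta <= x ->
  `|G (x + 1) + G (x + theta) - (G x + G (x + 1 - theta)) - 2 * theta * ln x| <= C / x.
Proof.
move=> th0.
(* For x >= theta, x + 1 - theta is at least k x. *)
pose k := Num.min 1 theta^-1.
have k0 : 0 < k by rewrite lt_min ltr01 invr_gt0.
have k1 : k <= 1 by rewrite ge_min lexx.
have kth x : theta <= x -> k * x <= x + (1 - theta).
  move=> tx; rewrite /k /Num.min.
  case: ifPn => [h|]; first by rewrite mul1r; move: h; rewrite invf_gt1//; lra.
  rewrite -leNgt invf_le1// => h.
  have : theta^-1 * theta = 1 by rewrite mulVf ?gt_eqF.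
  have : theta^-1 <= 1 by rewrite invf_le1.
  have : 0 < theta^-1 by rewrite invr_gt0.
  nra.
pose C (c : R) := `|c| / k.
have C0 c : 0 <= C c by rewrite /C divr_ge0// ltW.
have CS x c : theta <= x -> 1 - theta <= c \/ 0 <= c -> `|ln (x + c) - ln x| <= C c / x.
  move=> tx hc; apply: ln_shift => //; [lra|].
  have := kth x tx; case: hc => hc; [lra|nra].
pose D := C theta + C (1 - theta) + C (1 + theta) + C (2 - theta).
have CD c : c = 1 + theta \/ c = 1 - theta \/ c = 2 - theta \/ c = theta -> C c <= D.
  have := C0 theta; have := C0 (1 - theta); have := C0 (1 + theta); have := C0 (2 - theta).
  by rewrite /D => d1 d2 d3 d4 [->|[->|[->|->]]]; lra.
have D0 : 0 <= D by rewrite /D !addr_ge0.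
move: C D C0 CS CD D0 => C D C0 CS CD D0.
exists (C theta + C (1 - theta) + `|2 * theta - 1| * D + 1).
  by rewrite ltr_wpDl// !addr_ge0// mulr_ge0.
move=> x tx; have x0 : 0 < x by lra.
have p2 : 0 < x + theta by lra.
have p3 : 0 < x + 1 - theta by lra.
have Gl := logconvex_lower; have Gu := logconvex_upper.
(* Both ends are raised by one: the lower squeeze evaluates [ln] at one less than the
   lower end, which has to stay positive. *)
pose w := G (x + 1 + theta) - G (x + 2 - theta).
have e2 : G (x + theta) = G (x + 1 + theta) - ln (x + theta).
  have -> : x + 1 + theta = x + theta + 1 by ring.
  by rewrite GS//; ring.
have e3 : G (x + 1 - theta) = G (x + 2 - theta) - ln (x + 1 - theta).
  have -> : x + 2 - theta = x + 1 - theta + 1 by ring.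
  by rewrite GS//; ring.
have hw : `|w - (2 * theta - 1) * ln x| <= `|2 * theta - 1| * (D / x).
  have [t1|t1] := leP 1 (2 * theta).
    have a0 : 0 <= 2 * theta - 1 by lra.
    have := Gl (x + 2 - theta) (2 * theta - 1) ltac:(lra) a0.
    have := Gu (x + 2 - theta) (2 * theta - 1) ltac:(lra) a0.
    have -> : x + 2 - theta + (2 * theta - 1) = x + (1 + theta) by ring.
    have -> : x + 2 - theta - 1 = x + (1 - theta) by ring.
    have -> : G (x + (1 + theta)) - G (x + 2 - theta) = w by rewrite /w addrA.
    have := CS x (1 + theta) tx ltac:(right; lra).
    have := CS x (1 - theta) tx ltac:(left; lra).
    have DE c : c = 1 + theta \/ c = 1 - theta -> C c / x <= D / x.
      by move=> [->|->]; rewrite ler_pM2r ?invr_gt0//; apply: CD; [left|right; left].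
    move=> /le_trans /(_ (DE _ (or_intror erefl))) h1.
    move=> /le_trans /(_ (DE _ (or_introl erefl))) h2 h3 h4.
    rewrite (ger0_norm a0); move: h1 h2; rewrite !ler_norml => /andP[h1 h1'] /andP[h2 h2'].
    apply/andP; split; nra.
  have a0 : 0 <= 1 - 2 * theta by lra.
  have := Gl (x + 1 + theta) (1 - 2 * theta) ltac:(lra) a0.
  have := Gu (x + 1 + theta) (1 - 2 * theta) ltac:(lra) a0.
  have -> : x + 1 + theta + (1 - 2 * theta) = x + (2 - theta) by ring.
  have -> : x + 1 + theta - 1 = x + theta by ring.
  have -> : G (x + (2 - theta)) - G (x + 1 + theta) = - w by rewrite /w addrA; ring.
  have := CS x (2 - theta) tx ltac:(left; lra).
  have := CS x theta tx ltac:(right; lra).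
  have DE c : c = 2 - theta \/ c = theta -> C c / x <= D / x.
    by move=> [->|->]; rewrite ler_pM2r ?invr_gt0//; apply: CD; right; right; [left|right].
  move=> /le_trans /(_ (DE _ (or_intror erefl))) h1.
  move=> /le_trans /(_ (DE _ (or_introl erefl))) h2 h3 h4.
  have tn : 2 * theta - 1 < 0 by lra.
  rewrite (ltr0_norm tn).
  move: h1 h2; rewrite !ler_norml => /andP[h1 h1'] /andP[h2 h2'].
  apply/andP; split; nra.
have l1 := CS x theta tx ltac:(right; lra).
have l2 := CS x (1 - theta) tx ltac:(left; lra).
rewrite addrA in l2.
have x1 : 0 <= 1 / x by rewrite divr_ge0// ltW.
have -> : (C theta + C (1 - theta) + `|2 * theta - 1| * D + 1) / x =
    C theta / x + C (1 - theta) / x + `|2 * theta - 1| * (D / x) + 1 / x by ring.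
move: hw l1 l2; rewrite GS// e2 e3 /w !ler_norml.
move=> /andP[w1 w2] /andP[l1 l1'] /andP[l2 l2'].
apply/andP; split; lra.
Qed.

End LogConvex.

Lemma ln_ratio2 (a b c d : R) : 0 < a -> 0 < b -> 0 < c -> 0 < d ->
  0 < (a * b) / (c * d) /\ ln ((a * b) / (c * d)) = ln a + ln b - (ln c + ln d).
Proof.
move=> a0 b0 c0 d0; split; first by rewrite divr_gt0 ?mulr_gt0.
by rewrite ln_div ?posrE ?mulr_gt0// !lnM.
Qed.

Lemma ln_Qtheta (theta : R) : 0 < theta -> exists2 C : R, 0 < C &
  forall x, theta <= x -> 0 < Qtheta theta x /\ `|ln (Qtheta theta x) - 2 * theta * ln x| <= C / x.
Proof.
move=> th0.
have GS y : 0 < y -> ln (Gamma (y + 1)) = ln y + ln (Gamma y).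
  by move=> y0; rewrite (GammaS y0) lnM ?posrE//; exact: Gamma_gt0.
have [C C0 H] := @logconvex_ratio (fun z => ln (Gamma z)) GS (@Gamma_logconvex R) theta th0.
exists C => // x tx; have {}H := H x tx; have x0 : 0 < x by lra.
have p1 : 0 < x + 1 by lra. have p2 : 0 < x + theta by lra.
have p3 : 0 < x + 1 - theta by lra.
have [Q0 QE] := ln_ratio2 (Gamma_gt0 p1) (Gamma_gt0 p2) (Gamma_gt0 x0) (Gamma_gt0 p3).
split; first exact: Q0.
by rewrite /Qtheta QE.
Qed.

End Interaction.

(** * Square-root modulus of continuity of the potential *)

Section SqrtLipschitz.
Context {R : realType}.
Implicit Types (V : R -> R) (a x y u : R).

(** The factor u absorbs the logarithmic singularity at 0. *)
Lemma ln_mul_bound u a : 0 < u -> u ^+ 2 <= a -> u * `|ln u| <= a + 1.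
Proof.
move=> u0 ua; have h1 := ln_sublinear u0.
have h2 : - ln u < u^-1 by rewrite -lnV ?posrE// ln_sublinear// invr_gt0.
have u1 : u * u^-1 = 1 by rewrite divff ?gt_eqF.
case: (ger0P (ln u)) => h; nra.
Qed.

(** In the variable u = sqrt x the derivative of V is 2 u V' (u^2), which is bounded by
    [ln_mul_bound]; the mean value theorem applies to u |-> V (u^2). *)
Lemma sqrt_lipschitz V B (F2 : R -> R) : 0 < B ->
  {within `[0, +oo[, continuous V} ->
  (forall x, 0 < x -> derivable V x 1) ->
  (forall a x, 0 < a -> 0 < x -> x <= a -> `|derive1 V x| <= B * (F2 a + `|ln x|)) ->
  forall a, 0 < a -> exists2 L : R, 0 <= L &
  forall x y, 0 <= x -> x <= y -> y <= a -> `|V y - V x| <= L * (Num.sqrt y - Num.sqrt x).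
Proof.
move=> B0 cV dV hV a a0.
exists (2 * B * (a + 1) * (`|F2 a| + 2)).
  by rewrite !mulr_ge0// ?addr_ge0// ltW.
move=> x y x0 xy ya.
have y0 : 0 <= y by lra.
move: xy; rewrite le_eqVlt => /predU1P[->|xy].
  by rewrite !subrr normr0 mulr0.
have pq : Num.sqrt x < Num.sqrt y by rewrite ltr_sqrt//; lra.
set p := Num.sqrt x in pq *; set q := Num.sqrt y in pq *.
have p0 : 0 <= p by exact: sqrtr_ge0.
have xE : x = p ^+ 2 by rewrite sqr_sqrtr.
have yE : y = q ^+ 2 by rewrite sqr_sqrtr.
pose W u := V (u ^+ 2).
have dsq u : is_derive u 1 (fun u : R => u ^+ 2) (2 * u).
  have -> : (fun u : R => u ^+ 2) = (fun u => u) * (fun u => u).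
    by apply/funext => v; rewrite expr2.
  by apply: is_derive_eq; rewrite /GRing.scale/=; ring.
have dW u : 0 < u -> is_derive u 1 W (derive1 V (u ^+ 2) * (2 * u)).
  move=> u0; apply: (@is_derive1_comp R V (fun u => u ^+ 2) u) => //.
  have u20 : 0 < u ^+ 2 by rewrite exprn_gt0.
  by split; [exact: dV|rewrite derive1E].
have cW : {within `[p, q], continuous W}.
  apply/continuous_within_itvP => //; split.
  - move=> u; rewrite in_itv/= => /andP[pu _].
    have [d _] := dW u (le_lt_trans p0 pu).
    exact/differentiable_continuous/derivable1_diffP.
  - move: p0; rewrite le_eqVlt => /predU1P[p0|p0].
      have /continuous_within_itvcyP[_ V0] := cV.
      rewrite /W -p0 expr0n/=.
      apply/cvgrPdist_lt => e e0.
      move/cvgrPdist_lt : V0 => /(_ e e0) [d /= d0 hd]; near=> u.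
      have u0 : 0 < u by near: u; exact: nbhs_right_gt.
      have u1 : u < 1 by near: u; exact: nbhs_right_lt.
      have ud : u < d by near: u; exact: nbhs_right_lt.
      apply: hd; last by rewrite exprn_gt0.
      by rewrite /ball_/= sub0r normrN ger0_norm ?exprn_ge0 ?(ltW u0)// expr2; nra.
    have [d _] := dW p p0.
    by apply: cvg_at_right_filter; exact/differentiable_continuous/derivable1_diffP.
  - have [d _] := dW q (le_lt_trans p0 pq).
    by apply: cvg_at_left_filter; exact/differentiable_continuous/derivable1_diffP.
have [||c] := @MVT R W (fun u => derive1 V (u ^+ 2) * (2 * u)) p q pq.
- by move=> u; rewrite in_itv/= => /andP[pu _]; apply: dW; apply: le_lt_trans pu.
- exact: cW.
rewrite in_itv/= => /andP[pc cq]; rewrite /W -xE -yE => ->.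
have c0 : 0 < c by apply: le_lt_trans pc.
have c20 : 0 < c ^+ 2 by rewrite exprn_gt0.
have ca : c ^+ 2 <= a by rewrite (le_trans _ ya)// yE ler_pXn2r// ?nnegrE ltW// (lt_trans c0).
have := hV a (c ^+ 2) a0 c20 ca.
have -> : ln (c ^+ 2) = 2 * ln c by rewrite lnXn// mulr_natl.
rewrite normrM [`|2|]ger0_norm// => h.
have qp0 : 0 <= q - p by rewrite subr_ge0 ltW.
rewrite normrM (ger0_norm qp0) ler_wpM2r//.
rewrite normrM [`|2 * c|]ger0_norm; last by rewrite mulr_ge0// ltW.
have h1 := ln_mul_bound c0 ca.
have h2 := ler_norm (F2 a).
have ca1 : c <= a + 1 by nra.
apply: (@le_trans _ _ (B * (F2 a + 2 * `|ln c|) * (2 * c))).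
  by rewrite ler_wpM2r// mulr_ge0// ltW.
have -> : B * (F2 a + 2 * `|ln c|) * (2 * c) = 2 * B * (F2 a * c + 2 * (c * `|ln c|)) by ring.
have -> : 2 * B * (a + 1) * (`|F2 a| + 2) = 2 * B * ((a + 1) * (`|F2 a| + 2)) by ring.
have B20 : 0 <= 2 * B by rewrite mulr_ge0// ltW.
rewrite (ler_wpM2l B20)//.
have : F2 a * c <= `|F2 a| * (a + 1).
  by apply: (@le_trans _ _ (`|F2 a| * c)); [rewrite ler_wpM2r// ltW|rewrite ler_wpM2l].
lra.
Unshelve. all: by end_near. Qed.

End SqrtLipschitz.

(** * Partitions as particle positions *)

Section Lattice.
Context {R : realType}.
Variable theta : R.
Hypothesis theta_gt0 : 0 < theta.
Variable N : nat.
Implicit Types (lam : nat -> nat) (i j a b k : nat).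

(** Indices start at 0.  Partitions are functions on [nat] of which only the values below
    [N] matter, which makes index shifts free of casts. *)
Definition pos lam i : R := (lam i)%:R + (N - i.+1)%:R * theta.

Definition noninc lam := forall i j, (i <= j)%N -> (j < N)%N -> (lam j <= lam i)%N.

Lemma pos_ge0 lam i : 0 <= pos lam i.
Proof. by rewrite addr_ge0// mulr_ge0// ltW. Qed.

Lemma pos_gap lam i j : (i <= j)%N -> (j < N)%N ->
  pos lam i - pos lam j = (lam i)%:R - (lam j)%:R + (j - i)%:R * theta.
Proof.
move=> ij jN; rewrite /pos.
have -> : ((N - i.+1)%:R : R) = (N - j.+1)%:R + (j - i)%:R.
  by rewrite -natrD; congr (_%:R); lia.
ring.
Qed.

Lemma pos_gap_ge lam i j : noninc lam -> (i <= j)%N -> (j < N)%N ->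
  (j - i)%:R * theta <= pos lam i - pos lam j.
Proof.
move=> h ij jN; rewrite pos_gap// lerDr subr_ge0 ler_nat; exact: h.
Qed.

Lemma pos_anti lam i j : noninc lam -> (i <= j)%N -> (j < N)%N -> pos lam j <= pos lam i.
Proof.
move=> h ij jN; rewrite -subr_ge0; apply: le_trans (pos_gap_ge h ij jN).
by rewrite mulr_ge0// ltW.
Qed.

Lemma pos_gap_theta lam i j : noninc lam -> (i < j)%N -> (j < N)%N ->
  theta <= pos lam i - pos lam j.
Proof.
move=> h ij jN; apply: le_trans (pos_gap_ge h (ltnW ij) jN).
by rewrite ler_peMl ?(ltW theta_gt0)// ler1n subn_gt0.
Qed.

Lemma level_count lam (T : R) : noninc lam ->
  exists k, [/\ (k <= N)%N, (forall i, (i < k)%N -> T <= pos lam i) &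
     forall i, (k <= i)%N -> (i < N)%N -> pos lam i < T].
Proof.
move=> h.
suff H n : (n <= N)%N -> exists k, [/\ (k <= n)%N, (forall i, (i < k)%N -> T <= pos lam i) &
     forall i, (k <= i)%N -> (i < n)%N -> pos lam i < T].
  exact: H.
elim: n => [|n IH] nN; first by exists 0%N.
have [k [kn k1 k2]] := IH (ltnW nN).
have [kn'|kn'] := ltnP k n.
  exists k; split => //; first exact: leqW.
  move=> i ki; rewrite ltnS leq_eqVlt => /predU1P[->|]; last exact: k2.
  apply: le_lt_trans (k2 k (leqnn _) kn'); apply: pos_anti => //; exact: ltnW.
have {kn kn'}kn : k = n by lia.
subst k; have [Tn|nT] := leP T (pos lam n).
  exists n.+1; split => // i; last by lia.
  by rewrite ltnS leq_eqVlt => /predU1P[->|/k1].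
exists n; split => // i ni; rewrite ltnS => ni'.
by have -> : i = n by lia.
Qed.

End Lattice.

(** * Many distant particles: interaction *)

Section Refill.
Context {R : realType}.
Variables (theta : R) (N k : nat).
Hypothesis theta_gt0 : 0 < theta.
Hypotheses (k_gt0 : (0 < k)%N) (kN : (k <= N)%N).
Implicit Types (lam : nat -> nat) (i j x y : nat).

Let s : R := k%:R / N%:R / 2.

Let N_gt0 : 0 < (N%:R : R).
Proof. by rewrite ltr0n (leq_trans k_gt0). Qed.

Let s_ge0 : 0 <= s.
Proof. by rewrite /s !divr_ge0. Qed.

Let s_le : s <= 2^-1.
Proof. by rewrite /s ler_piMl// ler_pdivrMr// mul1r ler_nat. Qed.

(** The shifted particles move outwards by k theta minus this amount.  Capping at
    k theta leaves the particles away from the edge in place up to rounding, and the slope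
    k / (2 N) below the cap is small enough for the gaps to survive ([setback_lip]). *)
Definition setback x : nat := Num.truncn (Num.min (s * x%:R) (k%:R * theta)).

Let setback_arg_ge0 x : 0 <= Num.min (s * x%:R) (k%:R * theta).
Proof. by rewrite le_min !mulr_ge0// ltW. Qed.

Lemma setback_itv x : (setback x)%:R <= Num.min (s * x%:R) (k%:R * theta) < (setback x)%:R + 1.
Proof. by have := truncn_itv (setback_arg_ge0 x); rewrite -natr1. Qed.

Lemma setback_lip x y : (x <= y)%N -> (setback y)%:R - (setback x)%:R <= s * (y%:R - x%:R) + 1 :> R.
Proof.
move=> xy; have /andP[_ hx] := setback_itv x; have /andP[hy _] := setback_itv y.
have sxy : s * x%:R <= s * y%:R by rewrite ler_wpM2l// ler_nat.
have : Num.min (s * y%:R) (k%:R * theta) <= Num.min (s * x%:R) (k%:R * theta) + s * (y%:R - x%:R).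
  rewrite {2}/Num.min; case: ifP => _.
    by rewrite ge_min; apply/orP; left; lra.
  by rewrite ge_min; apply/orP; right; lra.
lra.
Qed.

Lemma setback_le x : (setback x <= x)%N.
Proof.
have /andP[h _] := setback_itv x.
rewrite -(ler_nat R); apply: (le_trans h); rewrite ge_min; apply/orP; left.
by rewrite ler_piMl//; have := s_le; lra.
Qed.

Lemma setback_homo x y : (x <= y)%N -> (x - setback x <= y - setback y)%N.
Proof.
move=> xy; have h := setback_lip xy.
have sx := setback_le x; have sy := setback_le y.
suff : (setback y < setback x + (y - x) + 1)%N by lia.
rewrite -(ltr_nat R) !natrD natrB//.
have : s * (y%:R - x%:R) <= 2^-1 * (y%:R - x%:R).
  by rewrite ler_wpM2r// subr_ge0 ler_nat.
have [->|xy'] := eqVneq y x.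
  by rewrite subrr; lra.
have : 1 <= y%:R - x%:R :> R.
  by rewrite -natrB// ler1n subn_gt0 ltn_neqAle eq_sym xy'.
lra.
Qed.

Definition refill lam j : nat :=
  if (j < N - k)%N then (lam (j + k) - setback (lam (j + k)))%N else 0%N.

Lemma refill_noninc lam : noninc N lam -> noninc N (refill lam).
Proof.
move=> h i j ij jN; rewrite /refill.
case: ifP => hj //; case: ifP => hi; last by lia.
apply: setback_homo; apply: h; lia.
Qed.

Lemma pos_refill lam j : (j < N - k)%N ->
  pos theta N (refill lam) j = pos theta N lam (j + k) + k%:R * theta - (setback (lam (j + k)))%:R.
Proof.
move=> jN; rewrite /pos /refill jN natrB ?setback_le//.
have -> : ((N - j.+1)%:R : R) = (N - (j + k).+1)%:R + k%:R by rewrite -natrD; congr (_%:R); lia.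
ring.
Qed.

Lemma pos_refill_new lam j : (N - k <= j)%N -> (j < N)%N ->
  0 <= pos theta N (refill lam) j <= k%:R * theta.
Proof.
move=> kj jN; rewrite /pos /refill ltnNge kj/= add0r mulr_ge0 ?(ltW theta_gt0)//=.
by rewrite ler_pM2r// ler_nat; lia.
Qed.

Variables (q : R -> R) (Cq : R).
Hypothesis Cq_ge0 : 0 <= Cq.
Hypothesis hq : forall x : R, theta <= x -> `|q x - 2 * theta * ln x| <= Cq / x.

(** A gap g becomes at least (1 - k / (2 N)) g - 1.  The rounding error 1 is paid by the
    summable term in 1 / (j - i), the contraction by the term in k / N. *)
Lemma refill_pair lam i j : noninc N lam -> (i < j)%N -> (j < N - k)%N ->
  q (pos theta N lam (i + k) - pos theta N lam (j + k)) <=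
  q (pos theta N (refill lam) i - pos theta N (refill lam) j)
    + (2 * theta + 2 * Cq) / theta * ((j - i)%:R)^-1 + 2 * theta * (k%:R / N%:R).
Proof.
move=> h ij jN.
have jkN : (j + k < N)%N by lia.
have ijk : (i + k <= j + k)%N by lia.
have iN : (i < N - k)%N by lia.
have jN' : (j < N)%N by lia.
have dE : (j - i = j + k - (i + k))%N by lia.
have h' := refill_noninc h.
set g := _ - _; set g' := pos _ _ _ i - _.
have d0 : 0 < ((j - i)%:R : R) by rewrite ltr0n subn_gt0.
have gd : (j - i)%:R * theta <= g.
  by rewrite dE; apply: pos_gap_ge.
have gd' : (j - i)%:R * theta <= g' by apply: pos_gap_ge => //; exact: ltnW.
have dt0 : 0 < (j - i)%:R * theta by rewrite mulr_gt0.
have d1 : 1 <= ((j - i)%:R : R) by rewrite ler1n subn_gt0.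
have dth : theta <= (j - i)%:R * theta by rewrite ler_peMl// ltW.
have gt : theta <= g by exact: le_trans gd.
have gt' : theta <= g' by exact: le_trans gd'.
have g0 : 0 < g by apply: lt_le_trans gt.
have g0' : 0 < g' by apply: lt_le_trans gt'.
have lamij : (lam (j + k) <= lam (i + k))%N by exact: h.
have lg0 : (lam (i + k))%:R - (lam (j + k))%:R <= g.
  by rewrite /g pos_gap// lerDl mulr_ge0// ltW.
have gE : g' = g - ((setback (lam (i + k)))%:R - (setback (lam (j + k)))%:R).
  by rewrite /g' /g !pos_refill//; ring.
have sl := setback_lip lamij.
have i1 : g^-1 <= ((j - i)%:R * theta)^-1 by rewrite lef_pV2 ?posrE.
have i2 : g'^-1 <= ((j - i)%:R * theta)^-1 by rewrite lef_pV2 ?posrE.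
have -> : (2 * theta + 2 * Cq) / theta * ((j - i)%:R)^-1 = (2 * theta + 2 * Cq) * ((j - i)%:R *
    theta)^-1.
  by rewrite invfM; ring.
have s2 : k%:R / N%:R = 2 * s by rewrite /s; field; rewrite gt_eqF.
have := hq gt; have := hq gt'; rewrite !ler_norml => /andP[a1 a2] /andP[b1 b2].
rewrite s2.
have s0 := s_ge0; have s1 := s_le.
move: g g' gd gd' gt gt' g0 g0' lg0 gE i1 i2 a1 a2 b1 b2.
move: ((j - i)%:R * theta)^-1 (s) s0 s1 sl => I s' s0 s1 sl.
move: (lam (i + k))%:R (lam (j + k))%:R (setback (lam (i + k)))%:R (setback (lam (j + k)))%:R sl.
move=> li lj si sj sl g g' gd gd' gt gt' g0 g0' lg0 gE i1 i2 a1 a2 b1 b2.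
have gg : g' >= (1 - s') * g - 1.
  have := ler_wpM2l s0 lg0; lra.
have lg : ln g <= ln g' + g'^-1 + 2 * s'.
  have p1 : 0 < g' + 1 by lra. have p2 : 0 < 1 + 2 * s' by lra.
  have h1 : g <= (g' + 1) * (1 + 2 * s').
    have m1 : 0 <= (g' + 1 - (1 - s') * g) * (1 + 2 * s') by rewrite mulr_ge0//; lra.
    have m2 : 0 <= (s' * (1 - 2 * s')) * g by rewrite !mulr_ge0//; lra.
    lra.
  apply: (@le_trans _ _ (ln ((g' + 1) * (1 + 2 * s')))).
    by rewrite ler_ln ?posrE ?mulr_gt0.
  rewrite lnM ?posrE//.
  have := @le_ln1Dx R (2 * s') ltac:(lra).
  have := ln_sub_le p1 g0'; rewrite addrAC subrr add0r mul1r; lra.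
have t2 : 0 <= 2 * theta by rewrite mulr_ge0// ltW.
have := ler_wpM2l t2 lg; have := ler_wpM2l Cq_ge0 i1.
have := ler_wpM2l Cq_ge0 i2; have := ler_wpM2l t2 i2.
lra.
Qed.

Definition pairs lam : R :=
  \sum_(0 <= i < N) \sum_(i.+1 <= j < N) q (pos theta N lam i - pos theta N lam j).

Definition pot (W : R -> R) lam : R :=
  \sum_(0 <= i < N) N%:R * W (pos theta N lam i / N%:R).

Lemma gap_sum_le (K : R) n i : 0 <= K -> (n <= N)%N ->
  \sum_(i.+1 <= j < n) K * ((j - i)%:R)^-1 <= K * (1 + ln N%:R).
Proof.
move=> K0 nN; rewrite -mulr_sumr ler_wpM2l//.
have N1 : 1 <= N%:R :> R by rewrite ler1n (leq_trans k_gt0).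
have lN := ln_ge0 N1.
have [ni|ni] := leqP n i.+1; first by rewrite big_geq//; lra.
rewrite -[i.+1]add1n big_addn.
under eq_bigr do rewrite addnK.
have n0 : (0 < n - i.+1)%N by rewrite subn_gt0.
have -> : (n - i = (n - i.+1).+1)%N by lia.
apply: le_trans (harmonic_le R n0) _.
rewrite lerD2l ler_ln ?posrE ?ltr0n//; last exact: leq_trans kN.
by rewrite ler_nat; lia.
Qed.

Lemma interaction_le lam a : noninc N lam -> (a < N)%N ->
  \sum_(a.+1 <= j < N) q (pos theta N lam a - pos theta N lam j) <=
  (N - a.+1)%:R * (2 * theta * ln (pos theta N lam a) + Cq / theta).
Proof.
move=> h aN; apply: sum_const_le => // j /andP[aj jN].
have gt := pos_gap_theta theta_gt0 h aj jN.
have p0 := pos_ge0 theta_gt0 N lam j.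
move: gt p0; move: (pos theta N lam a) (pos theta N lam j) => p r gt p0.
have := hq gt; rewrite ler_norml => /andP[_ h2].
have g0 : 0 < p - r by exact: lt_le_trans gt.
have l1 : ln (p - r) <= ln p by rewrite ler_ln ?posrE//; lra.
have l2 : Cq / (p - r) <= Cq / theta by rewrite ler_wpM2l// lef_pV2 ?posrE.
have t2 : 0 <= 2 * theta by rewrite mulr_ge0// ltW.
have := ler_wpM2l t2 l1; lra.
Qed.

(** The i-th particle above [j] is at distance at least i theta, so the interaction is at
    least 2 theta ln (j!), up to terms linear in N. *)
Lemma interaction_ge lam j : noninc N lam -> (j < N)%N ->
  2 * theta * (j%:R * ln N%:R) - N%:R * (2 * theta + 2 * theta * `|ln theta| + Cq / theta)
  <= \sum_(0 <= i < j) q (pos theta N lam i - pos theta N lam j).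
Proof.
move=> h jN.
have t2 : 0 <= 2 * theta by rewrite mulr_ge0// ltW.
apply: (@le_trans _ _ (\sum_(0 <= i < j)
    (2 * theta * ln ((j - i)%:R : R) + (2 * theta * ln theta - Cq / theta)))); last first.
  apply: ler_sum_nat => i /andP[_ ij].
  have gt := pos_gap_theta theta_gt0 h ij jN.
  have gd := pos_gap_ge theta_gt0 h (ltnW ij) jN.
  have d0 : 0 < ((j - i)%:R : R) by rewrite ltr0n subn_gt0.
  have := hq gt; rewrite ler_norml => /andP[h1 _].
  move: gt gd h1; move: (_ - pos _ _ _ _) (_%:R : R) d0 => g d d0 gt gd h1.
  have g0 : 0 < g by exact: lt_le_trans gt.
  have l1 : ln d + ln theta <= ln g by rewrite -lnM ?posrE// ler_ln ?posrE ?mulr_gt0.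
  have l2 : Cq / g <= Cq / theta by rewrite ler_wpM2l// lef_pV2 ?posrE.
  have := ler_wpM2l t2 l1; lra.
rewrite big_split/= -mulr_sumr sum_ln_fact sumr_const_nat subn0 -[_ *+ j]mulr_natl.
have lf := ler_wpM2l t2 (@ln_fact_ge R j N (leq_trans k_gt0 kN)).
have jN' : j%:R <= N%:R :> R by rewrite ler_nat ltnW.
have j0 : 0 <= j%:R :> R by [].
have c0 : 0 <= Cq / theta by rewrite divr_ge0// ltW.
have e1 : - (N%:R * (2 * theta * `|ln theta|)) <= j%:R * (2 * theta * ln theta).
  have a1 := ler_norm (- ln theta); rewrite normrN in a1.
  have := ler_wpM2l (mulr_ge0 j0 t2) a1.
  have := ler_wpM2r (mulr_ge0 t2 (normr_ge0 (ln theta))) jN'.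
  lra.
have e2 := ler_wpM2r c0 jN'.
lra.
Qed.

(** The a-th removed particle is exchanged for the new particle of index N - a - 1, which
    interacts with equally many others.  The terms in ln N on both sides cancel, and only
    2 theta N ln (x_a) is lost, up to O(N). *)
Lemma refill_swap lam a : noninc N lam -> (a < k)%N -> N%:R <= pos theta N lam a ->
  \sum_(a.+1 <= j < N) q (pos theta N lam a - pos theta N lam j) <=
  \sum_(0 <= i < N - a.+1)
     q (pos theta N (refill lam) i - pos theta N (refill lam) (N - a.+1))
  + (2 * theta * N%:R * ln (pos theta N lam a / N%:R)
     + (2 * (Cq / theta) + 2 * theta + 2 * theta * `|ln theta|) * N%:R).
Proof.
move=> h ak Np.
have aN : (a < N)%N := leq_trans ak kN.
have := interaction_le h aN.
have := @interaction_ge (refill lam) (N - a.+1) (refill_noninc h) ltac:(lia).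
have d0 : 0 <= ((N - a.+1)%:R : R) by [].
have dN : ((N - a.+1)%:R : R) <= N%:R by rewrite ler_nat leq_subr.
move: (\sum_(a.+1 <= j < N) _) (\sum_(0 <= i < N - a.+1) _) => S S'.
have p0 : 0 < pos theta N lam a by exact: lt_le_trans Np.
have x0 : 0 <= ln (pos theta N lam a / N%:R) by rewrite ln_ge0// ler_pdivlMr// mul1r.
have xE : ln (pos theta N lam a / N%:R) = ln (pos theta N lam a) - ln N%:R by rewrite ln_div ?posrE.
move: xE x0; move: (ln (_ / _)) (ln (pos _ _ _ _)) (ln N%:R) (`|ln theta|) => lx lp lN lt xE x0.
move: N_gt0 d0 dN; move: (_%:R) (_%:R) => n d n0 d0 dN h1 h2.
have c0 : 0 <= Cq / theta by rewrite divr_ge0// ltW.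
have t2 : 0 <= 2 * theta by rewrite mulr_ge0// ltW.
have e1 := ler_wpM2r c0 dN.
have e2 := ler_wpM2r (mulr_ge0 t2 x0) dN.
have e3 : lp = lx + lN by lra.
rewrite e3 in h2; lra.
Qed.

Lemma refill_pairs lam : noninc N lam ->
  (forall a, (a < k)%N -> N%:R <= pos theta N lam a) ->
  pairs lam <= pairs (refill lam)
    + 2 * theta * N%:R * \sum_(0 <= a < k) ln (pos theta N lam a / N%:R)
    + (2 * (Cq / theta) + 4 * theta + 2 * theta * `|ln theta|) * (k%:R * N%:R)
    + (2 * theta + 2 * Cq) / theta * (N%:R * (1 + ln N%:R)).
Proof.
move=> h hk; have h' := refill_noninc h.
set K := (2 * theta + 2 * Cq) / theta.
have K0 : 0 <= K by rewrite /K divr_ge0 ?addr_ge0 ?mulr_ge0// ltW.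
rewrite {1}/pairs (@big_cat_nat _ _ _ k)//=.
have -> : \sum_(k <= i < N) \sum_(i.+1 <= j < N) q (pos theta N lam i - pos theta N lam j)
  = \sum_(0 <= i < N - k) \sum_(i.+1 <= j < N - k) q (pos theta N lam (i + k) - pos theta N lam (j
      + k)).
  rewrite -{1}[k]add0n big_addn; apply: eq_bigr => i _.
  by rewrite -addSn big_addn.
have -> : pairs (refill lam) =
  \sum_(0 <= i < N - k) \sum_(i.+1 <= j < N - k)
     q (pos theta N (refill lam) i - pos theta N (refill lam) j)
  + \sum_(0 <= a < k) \sum_(0 <= i < N - a.+1)
     q (pos theta N (refill lam) i - pos theta N (refill lam) (N - a.+1)).
  rewrite /pairs -exchange_pairs (@big_cat_nat _ _ _ (N - k))//=; last exact: leq_subr.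
  rewrite exchange_pairs; congr (_ + _).
  exact: (@sum_nat_top R (fun j => \sum_(0 <= i < j) q (pos theta N (refill lam) i - pos theta N
      (refill lam) j)) k N kN).
pose A a := \sum_(a.+1 <= j < N) q (pos theta N lam a - pos theta N lam j).
pose A' a := \sum_(0 <= i < N - a.+1)
     q (pos theta N (refill lam) i - pos theta N (refill lam) (N - a.+1)).
rewrite -/(\sum_(0 <= a < k) A a) -/(\sum_(0 <= a < k) A' a).
set M := \sum_(0 <= i < N - k) _; set M' := \sum_(0 <= i < N - k) _.
have hM : M <= M' + 2 * theta * (k%:R * N%:R) + K * (N%:R * (1 + ln N%:R)).
  rewrite -addrA.
  have -> : 2 * theta * (k%:R * N%:R) + K * (N%:R * (1 + ln N%:R)) =
    N%:R * (K * (1 + ln N%:R) + 2 * theta * k%:R) by ring.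
  have lN : 0 <= ln (N%:R : R) by rewrite ln_ge0// ler1n (leq_trans k_gt0).
  rewrite -lerBlDl -sumrB.
  apply: (@le_trans _ _ ((N - k - 0)%:R * (K * (1 + ln N%:R) + 2 * theta * k%:R))); last first.
    apply: ler_wpM2r; last by rewrite ler_nat; lia.
    have X1 : 0 <= K * (1 + ln N%:R) by rewrite mulr_ge0// addr_ge0.
    have X2 : 0 <= 2 * theta * k%:R by rewrite !mulr_ge0// ltW.
    exact: addr_ge0.
  apply: sum_const_le => // i /andP[_ iNk].
  rewrite -sumrB.
  apply: (@le_trans _ _ (\sum_(i.+1 <= j < N - k) (K * ((j - i)%:R)^-1 + 2 * theta * (k%:R /
      N%:R)))).
    apply: ler_sum_nat => j /andP[ij jN].
    by rewrite lerBlDl addrA; exact: refill_pair.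
  rewrite big_split/= lerD//; first by apply: gap_sum_le => //; exact: leq_subr.
  rewrite sumr_const_nat -[_ *+ (_ - _)]mulr_natl.
  apply: (@le_trans _ _ (N%:R * (2 * theta * (k%:R / N%:R)))).
    apply: ler_wpM2r; last by rewrite ler_nat; lia.
    by rewrite !mulr_ge0 ?divr_ge0// ltW.
  by rewrite le_eqVlt; apply/orP; left; apply/eqP; field; rewrite gt_eqF.
have hA : \sum_(0 <= a < k) A a <= \sum_(0 <= a < k) A' a + 2 * theta * N%:R * \sum_(0 <= a < k) ln
    (pos theta N lam a / N%:R)
    + (2 * (Cq / theta) + 2 * theta + 2 * theta * `|ln theta|) * (k%:R * N%:R).
  apply: (@le_trans _ _ (\sum_(0 <= a < k) (A' a + (2 * theta * N%:R * ln (pos theta N lam a / N%:R)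
     + (2 * (Cq / theta) + 2 * theta + 2 * theta * `|ln theta|) * N%:R)))).
    by apply: ler_sum_nat => a /andP[_ ak]; apply: refill_swap => //; exact: hk.
  rewrite big_split/= big_split/= -mulr_sumr sumr_const_nat subn0 -[_ *+ k]mulr_natl addrA lerD2l.
  by rewrite le_eqVlt; apply/orP; left; apply/eqP; ring.
move: hM hA; move: (\sum_(0 <= a < k) A a) (\sum_(0 <= a < k) A' a) M M' => x1 x2 x3 x4.
move: (\sum_(_ <= _ < _) _) => x5.
lra.
Qed.

End Refill.

(** * Many distant particles: potential *)

Lemma inv_sqrt_le (R : realType) (a b : R) : 0 < a -> a <= b -> (Num.sqrt b)^-1 <= (Num.sqrt a)^-1.
Proof.
move=> a0 ab; have b0 : 0 < b by exact: lt_le_trans ab.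
by rewrite lef_pV2 ?posrE ?sqrtr_gt0// ler_wsqrtr.
Qed.

Section RefillPotential.
Context {R : realType}.
Variables (theta : R) (N k : nat).
Hypothesis theta_gt0 : 0 < theta.
Hypotheses (k_gt0 : (0 < k)%N) (kN : (k <= N)%N).
Variables (V W : R -> R) (T L4 LT E M : R).
Hypothesis T_ge1 : 1 <= T.
Hypotheses (L4_ge0 : 0 <= L4) (LT_ge0 : 0 <= LT).
Hypothesis hL4 : forall x y : R, 0 <= x -> x <= y -> y <= 4 * theta ->
  `|V y - V x| <= L4 * (Num.sqrt y - Num.sqrt x).
Hypothesis hLT : forall x y : R, 0 <= x -> x <= y -> y <= T + theta ->
  `|V y - V x| <= LT * (Num.sqrt y - Num.sqrt x).
Hypothesis hE : forall x : R, 0 <= x -> x <= T + theta -> `|W x - V x| <= E.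
Hypothesis hM : forall x : R, 0 <= x -> x <= theta -> W x <= M.

Let N_gt0 : 0 < (N%:R : R).
Proof. by rewrite ltr0n (leq_trans k_gt0). Qed.

(** The second case is the one near the edge, where the displacement may be as large as
    k theta.  Its range 4 theta N does not grow with the level T, so that the modulus of V
    needed there does not depend on T. *)
Lemma setback_gap lam i : (i < N - k)%N ->
  let p := pos theta N lam (i + k) in
  let p' := pos theta N (refill theta N k lam) i in
  p <= p' <= p + k%:R * theta /\
  (p' <= p + 1 /\ 2 * theta * N%:R <= p \/ p' <= 4 * theta * N%:R).
Proof.
move=> iNk /=.
have kR : (k%:R : R) <= N%:R by rewrite ler_nat.
have k1 : 1 <= (k%:R : R) by rewrite ler1n.
have pE := pos_refill theta_gt0 k_gt0 kN lam iNk.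
have lp : (lam (i + k))%:R <= pos theta N lam (i + k) by rewrite /pos lerDl mulr_ge0// ltW.
have pl : pos theta N lam (i + k) <= (lam (i + k))%:R + N%:R * theta.
  by rewrite /pos lerD2l ler_pM2r// ler_nat; lia.
have /andP[f1 f2] := setback_itv N k theta_gt0 (lam (i + k)).
have f0 : 0 <= (setback theta N k (lam (i + k)))%:R :> R by [].
move: pE lp pl f1 f2 f0.
move: (pos theta N (refill theta N k lam) i) (pos theta N lam (i + k)) ((lam (i + k))%:R : R)
    ((setback theta N k (lam (i + k)))%:R : R).
move=> p' p l f pE lp pl f1 f2 f0.
have n0 := N_gt0.
move: f1; rewrite le_min => /andP[f1 f1'].
split; first by apply/andP; split; lra.
have sE : k%:R / N%:R / 2 * l * (2 * N%:R) = k%:R * l.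
  by field; rewrite gt_eqF.
have kt : k%:R * theta <= N%:R * theta by rewrite ler_pM2r.
have [h|h] := leP (2 * theta * N%:R) l.
  left; split; last lra.
  move: f2; rewrite /Num.min; case: ifP => // h'; last lra.
  exfalso.
  have a1 : k%:R / N%:R / 2 * l * (2 * N%:R) < k%:R * theta * (2 * N%:R).
    by rewrite ltr_pM2r// mulr_gt0.
  have a2 : 0 <= k%:R * (l - 2 * theta * N%:R) by rewrite mulr_ge0// subr_ge0.
  lra.
by right; lra.
Qed.

(** Near the edge, the particle with m others below it sits at height at least m theta,
    where a displacement k theta changes sqrt (p / N) by at most a multiple of
    k / sqrt (N (m + 1)). *)
Lemma refill_pot_shift lam i : (i < N - k)%N ->
  pos theta N lam (i + k) < T * N%:R ->
  W (pos theta N (refill theta N k lam) i / N%:R) <= W (pos theta N lam (i + k) / N%:R)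
   + (2 * E + LT / Num.sqrt (2 * theta) / N%:R
      + L4 * Num.sqrt theta * (k%:R / Num.sqrt N%:R) * (Num.sqrt (N - k - i)%:R)^-1).
Proof.
move=> iNk pT.
have mE0 : (N - k - i = (N - (i + k).+1).+1)%N by lia.
have /= [/andP[pp' p'p] C] := setback_gap lam iNk.
have pm : (N - (i + k).+1)%:R * theta <= pos theta N lam (i + k) by rewrite /pos lerDr.
have p0 := pos_ge0 theta_gt0 N lam (i + k).
have kR : (k%:R : R) <= N%:R by rewrite ler_nat.
have k1 : 1 <= (k%:R : R) by rewrite ler1n.
have mE : ((N - k - i)%:R : R) = (N - (i + k).+1)%:R + 1 by rewrite natr1 mE0.
have m0 : 0 <= ((N - (i + k).+1)%:R : R) by [].
rewrite mE; move: m0 pm pp' p'p C pT p0; have n0 := N_gt0; clear mE mE0 iNk.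
move: ((N - (i + k).+1)%:R) (pos theta N (refill theta N k lam) i) (pos theta N lam (i + k)) => m
    p' p.
move: n0 k1 kR; move: (N%:R : R) (k%:R : R) => n K n0 k1 kR m0 pm pp' p'p C pT p0.
set x := p / n; set x' := p' / n.
have x0 : 0 <= x by rewrite divr_ge0// ltW.
have xx' : x <= x' by rewrite ler_pM2r ?invr_gt0.
have x'T : x' <= T + theta.
  rewrite ler_pdivrMr//; have : K * theta <= n * theta by rewrite ler_pM2r.
  lra.
have hx := hE x0 ltac:(lra). have hx' := hE (le_trans x0 xx') x'T.
have VV : `|V x' - V x| <= LT / Num.sqrt (2 * theta) / n
      + L4 * Num.sqrt theta * (K / Num.sqrt n) * (Num.sqrt (m + 1))^-1.
  have A1 : 0 <= LT / Num.sqrt (2 * theta) / n by rewrite !divr_ge0 ?sqrtr_ge0// ltW.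
  have A2 : 0 <= L4 * Num.sqrt theta * (K / Num.sqrt n) * (Num.sqrt (m + 1))^-1.
    by rewrite !mulr_ge0 ?invr_ge0 ?sqrtr_ge0//; lra.
  case: C => [[p1 p2]|p4].
    have x2 : 2 * theta <= x by rewrite ler_pdivlMr.
    have xp : 0 < x by apply: lt_le_trans x2; rewrite mulr_gt0.
    apply: le_trans (hLT x0 xx' x'T) _.
    have h1 := sqrtrB_le xp xx'.
    have h2 : x' - x <= n^-1 by rewrite -mulrBl ler_piMl ?invr_ge0 ?(ltW n0)//; rewrite lerBlDl.
    have h3 : (x' - x) / Num.sqrt x <= n^-1 / Num.sqrt (2 * theta).
      rewrite ler_pM ?invr_ge0 ?sqrtr_ge0 ?subr_ge0//.
      by apply: inv_sqrt_le; rewrite ?mulr_gt0.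
    have := ler_wpM2l LT_ge0 (le_trans h1 h3).
    have -> : LT * (n^-1 / Num.sqrt (2 * theta)) = LT / Num.sqrt (2 * theta) / n by ring.
    lra.
  have x4 : x' <= 4 * theta by rewrite ler_pdivrMr.
  apply: le_trans (hL4 x0 xx' x4) _.
  (* y is the largest position that the particle can reach. *)
  pose y := x + K * theta / n.
  have d0 : 0 < K * theta / n by rewrite !mulr_gt0 ?invr_gt0//; lra.
  have y0 : 0 < y by rewrite /y ltr_wpDl.
  have x'y : x' <= y by rewrite /y /x -mulrDl ler_pM2r ?invr_gt0.
  have h1 : Num.sqrt x' - Num.sqrt x <= Num.sqrt y - Num.sqrt x.
    by rewrite lerD2r ler_wsqrtr.
  have h2 := sqrtrB_le_top x0 (le_trans xx' x'y) y0.
  have yE : y - x = K * theta / n by rewrite /y; ring.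
  rewrite yE in h2.
  have my : (m + 1) * theta / n <= y.
    rewrite /y /x -mulrDl ler_pM2r ?invr_gt0//.
    have : 0 <= (K - 1) * theta by rewrite mulr_ge0 ?subr_ge0// ltW.
    lra.
  have m1 : 0 < m + 1 by lra.
  have h3 : K * theta / n / Num.sqrt y <= K * theta / n / Num.sqrt ((m + 1) * theta / n).
    by rewrite ler_wpM2l ?(ltW d0)//; apply: inv_sqrt_le; rewrite ?mulr_gt0 ?invr_gt0.
  have h4 : K * theta / n / Num.sqrt ((m + 1) * theta / n) =
     Num.sqrt theta * (K / Num.sqrt n) * (Num.sqrt (m + 1))^-1.
    rewrite sqrtrM ?mulr_ge0 ?(ltW theta_gt0) ?(ltW m1)// sqrtrM ?(ltW m1)// sqrtrV ?(ltW n0)//.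
    have st : Num.sqrt theta ^+ 2 = theta by rewrite sqr_sqrtr// ltW.
    have sn : Num.sqrt n ^+ 2 = n by rewrite sqr_sqrtr// ltW.
    rewrite -[in K * theta]st -[in X in X / _ = _]sn.
    have : 0 < Num.sqrt theta by rewrite sqrtr_gt0.
    have : 0 < Num.sqrt n by rewrite sqrtr_gt0.
    have : 0 < Num.sqrt (m + 1) by rewrite sqrtr_gt0.
    move: (Num.sqrt _) (Num.sqrt _) (Num.sqrt _) => a b c a0 b0 c0.
    by field; rewrite !gt_eqF.
  rewrite h4 in h3.
  have := ler_wpM2l L4_ge0 (le_trans h1 (le_trans h2 h3)).
  rewrite !mulrA in A2 *; lra.
move: hx hx' VV; rewrite !ler_norml => /andP[a1 a2] /andP[b1 b2] /andP[c1 c2].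
lra.
Qed.

(** Summing 1 / sqrt m over the particles turns the cost of the displacements near the edge
    into O(k N) with a constant independent of T. *)
Lemma refill_pot lam (b : R) : 0 <= b ->
  (forall x : R, 1 <= x -> b * ln x <= W x) ->
  (forall a, (a < k)%N -> T * N%:R <= pos theta N lam a) ->
  (forall a, (k <= a)%N -> (a < N)%N -> pos theta N lam a < T * N%:R) ->
  pot theta N W (refill theta N k lam) <= pot theta N W lam
    - b * N%:R * \sum_(0 <= a < k) ln (pos theta N lam a / N%:R)
    + (`|M| + 2 * L4 * Num.sqrt theta) * (k%:R * N%:R)
    + (2 * `|E| * N%:R ^+ 2 + LT / Num.sqrt (2 * theta) * N%:R).
Proof.
move=> b0 hb hk1 hk2.
rewrite /pot (@big_cat_nat _ _ _ (N - k))//=; last exact: leq_subr.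
rewrite [\sum_(0 <= i < N) N%:R * W (pos theta N lam i / N%:R)](@big_cat_nat _ _ _ k)//=.
have -> : \sum_(k <= i < N) N%:R * W (pos theta N lam i / N%:R) =
    \sum_(0 <= i < N - k) N%:R * W (pos theta N lam (i + k) / N%:R).
  by rewrite -{1}[k]add0n big_addn.
set A := \sum_(0 <= i < N - k) N%:R * W (pos theta N (refill theta N k lam) i / N%:R).
set B := \sum_(N - k <= i < N) _.
set C := \sum_(0 <= i < k) _; set D := \sum_(0 <= i < N - k) _.
set S := \sum_(0 <= a < k) _.
have hC : b * N%:R * S <= C.
  rewrite /S mulr_sumr; apply: ler_sum_nat => a /andP[_ ak].
  rewrite [b * _]mulrC -mulrA ler_wpM2l// hb//.
  by rewrite ler_pdivlMr// mul1r (le_trans _ (hk1 a ak))// ler_peMl// ltW.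
have hB : B <= `|M| * (k%:R * N%:R).
  apply: (@le_trans _ _ ((N - (N - k))%:R * (N%:R * `|M|))).
    apply: sum_const_le; first exact: leq_subr.
    move=> i /andP[ki iN]; rewrite ler_pM2l//.
    have /andP[p1 p2] := pos_refill_new theta_gt0 k_gt0 kN lam ki iN.
    apply: le_trans (ler_norm M); apply: hM; first by rewrite divr_ge0// ltW.
    rewrite ler_pdivrMr// (le_trans p2)// mulrC ler_pM2l// ler_nat//.
  by rewrite subKn// le_eqVlt; apply/orP; left; apply/eqP; ring.
have hA : A <= D + 2 * L4 * Num.sqrt theta * (k%:R * N%:R)
  + (2 * `|E| * N%:R ^+ 2 + LT / Num.sqrt (2 * theta) * N%:R).
  apply: (@le_trans _ _ (\sum_(0 <= i < N - k) (N%:R * W (pos theta N lam (i + k) / N%:R)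
     + ((2 * `|E| * N%:R + LT / Num.sqrt (2 * theta))
      + L4 * Num.sqrt theta * (k%:R * N%:R / Num.sqrt N%:R) * (Num.sqrt (N - k - i)%:R)^-1)))).
    apply: ler_sum_nat => i /andP[_ iNk].
    have iN' : (i + k < N)%N by lia.
    have H := @refill_pot_shift lam i iNk (hk2 _ (leq_addl _ _) iN').
    apply: (le_trans (ler_wpM2l (ltW N_gt0) H)).
    rewrite mulrDr lerD2l 2!mulrDr lerD//; last first.
      by rewrite le_eqVlt; apply/orP; left; apply/eqP; ring.
    rewrite [N%:R * (LT / _ / _)]mulrC divfK ?gt_eqF// lerD2r mulrC ler_wpM2r ?(ltW N_gt0)//.
    by rewrite ler_wpM2l// ler_norm.
  rewrite big_split/= -/D -addrA lerD2l big_split/= addrC lerD//.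
    rewrite -mulr_sumr.
    have -> : \sum_(0 <= i < N - k) (Num.sqrt ((N - k - i)%:R : R))^-1
        = \sum_(0 <= m < N - k) (Num.sqrt (m.+1%:R : R))^-1.
      rewrite [LHS]big_nat_rev/= add0n; apply: eq_big_nat => m /andP[_ mN].
      by congr (Num.sqrt _%:R)^-1; lia.
    have h1 := @sum_inv_sqrt_le R (N - k).
    have h2 : Num.sqrt ((N - k)%:R : R) <= Num.sqrt N%:R by rewrite ler_wsqrtr// ler_nat leq_subr.
    have h3 : 0 <= L4 * Num.sqrt theta * (k%:R * N%:R / Num.sqrt N%:R).
      by rewrite !mulr_ge0 ?invr_ge0 ?sqrtr_ge0.
    apply: (@le_trans _ _ (L4 * Num.sqrt theta * (k%:R * N%:R / Num.sqrt N%:R) * (2 * Num.sqrt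
        N%:R))).
      by apply: ler_wpM2l => //; lra.
    have sn : Num.sqrt (N%:R : R) != 0 by rewrite gt_eqF// sqrtr_gt0.
    by rewrite le_eqVlt; apply/orP; left; apply/eqP; field.
  rewrite sumr_const_nat subn0 -[_ *+ (_ - _)]mulr_natl.
  apply: (@le_trans _ _ (N%:R * (2 * `|E| * N%:R + LT / Num.sqrt (2 * theta)))).
    apply: ler_wpM2r; last by rewrite ler_nat leq_subr.
    by rewrite addr_ge0 ?divr_ge0 ?mulr_ge0 ?sqrtr_ge0.
  by rewrite le_eqVlt; apply/orP; left; apply/eqP; ring.
move: hA hB hC; move: A B C D S => A B C D S; lra.
Qed.

End RefillPotential.

(** * Few distant particles *)

Section Shelve.
Context {R : realType}.
Variables (theta : R) (N : nat).
Hypothesis theta_gt0 : 0 < theta.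
Hypothesis N_gt0 : (0 < N)%N.
Implicit Types (lam : nat -> nat) (i j a b k : nat).

(** The extra theta keeps the moved particles clear of particle k, which lies below T N,
    and the successor makes up for the truncation. *)
Definition shelf (T : R) k : nat := (Num.truncn (T * N%:R + theta - (N - k)%:R * theta)).+1.

Definition shelve (T : R) k lam i : nat := if (i < k)%N then shelf T k else lam i.

Lemma pos_shelve (T : R) k lam i : theta <= T -> (k <= N)%N -> (i < k)%N ->
  T * N%:R <= pos theta N (shelve T k lam) i <= T * N%:R + k%:R * theta + theta + 1.
Proof.
move=> tT kN ik; rewrite /pos /shelve ik /shelf.
have n0 : 0 < (N%:R : R) by rewrite ltr0n.
have x0 : 0 <= T * N%:R + theta - (N - k)%:R * theta.
  rewrite natrB//; have : theta * N%:R <= T * N%:R by rewrite ler_pM2r.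
  have : 0 <= k%:R * theta by rewrite mulr_ge0// ltW.
  by move: (k%:R) (N%:R) theta_gt0 => u v; lra.
have := truncn_itv x0; rewrite -natr1 => /andP[].
have -> : ((N - i.+1)%:R : R) = (N - k)%:R + (k - i.+1)%:R.
  by rewrite -natrD; congr (_%:R); lia.
have d1 : 0 <= (k - i.+1)%:R * theta by rewrite mulr_ge0// ltW.
have d2 : (k - i.+1)%:R * theta <= k%:R * theta by rewrite ler_pM2r// ler_nat leq_subr.
move: ((Num.truncn _)%:R) d1 d2 => t; rewrite mulrDl => d1 d2 h1 h2.
have := theta_gt0; move: d1 d2 h1 h2; move: ((N - k)%:R * theta) ((k - i.+1)%:R * theta) (k%:R *
    theta) (T * N%:R).
by move=> u1 u2 u3 u4 d1 d2 h1 h2 t0; apply/andP; split; lra.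
Qed.

Lemma pos_shelve_ge (T : R) k lam i : (k <= i)%N ->
  pos theta N (shelve T k lam) i = pos theta N lam i.
Proof. by move=> ki; rewrite /pos /shelve ltnNge ki. Qed.

Lemma shelve_noninc (T : R) k lam : (k <= N)%N -> noninc N lam ->
  (forall i, (k <= i)%N -> (i < N)%N -> pos theta N lam i < T * N%:R) ->
  theta <= T -> noninc N (shelve T k lam).
Proof.
move=> kN h hk tT i j ij jN; rewrite /shelve.
case: ifP => jk; case: ifP => ik //; last exact: h.
  by lia.
have kN' : (k < N)%N by lia.
have kj : (k <= j)%N by rewrite leqNgt jk.
apply: leq_trans (h k j kj jN) _.
have := hk k (leqnn _) kN'; rewrite /pos /shelf => hp.
have x0 : 0 <= T * N%:R + theta - (N - k)%:R * theta.
  have n0 : 0 <= (N%:R : R) by [].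
  rewrite natrB//; have : theta * N%:R <= T * N%:R by rewrite ler_wpM2r.
  have : 0 <= k%:R * theta by rewrite mulr_ge0// ltW.
  by move: (k%:R) (N%:R) theta_gt0 => u v; lra.
have := truncn_itv x0 => /andP[_ h2].
apply: ltnW; rewrite -(ltr_nat R); apply: lt_trans h2.
have e : ((N - k)%:R : R) = (N - k.+1)%:R + 1 by rewrite natr1; congr (_%:R); lia.
rewrite e; lra.
Qed.

Variables (q : R -> R) (Cq : R).
Hypothesis Cq_ge0 : 0 <= Cq.
Hypothesis hq : forall x : R, theta <= x -> `|q x - 2 * theta * ln x| <= Cq / x.

Let q_le x : theta <= x -> q x <= 2 * theta * ln x + Cq / x.
Proof. by move=> /hq; rewrite ler_norml => /andP[_]; lra. Qed.

Let q_ge x : theta <= x -> 2 * theta * ln x - Cq / x <= q x.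
Proof. by move=> /hq; rewrite ler_norml => /andP[h _]; lra. Qed.

(** As a function of y, the ratio (p n - y) / (p' - y) is largest at the top y = s n of
    the bulk, where it is at most (p - s) / (t - s). *)
Lemma shelve_far (p t y s n : R) : 0 < n -> 1 <= t - s -> t <= p -> y <= s * n ->
  forall p' : R, t * n <= p' -> theta <= p' - y -> theta <= p * n - y ->
  q (p * n - y) <= q (p' - y) + (2 * theta * (ln (p - s) - ln (t - s)) + 2 * Cq / n).
Proof.
move=> n0 ts tp ys p' hp' g1 g2.
have t2 : 0 <= 2 * theta by rewrite mulr_ge0// ltW.
have ts0 : 0 < t - s by lra.
have ps0 : 0 < p - s by lra.
have hn (u : R) : 0 <= u - 1 -> n <= u * n by move=> u1; have := mulr_ge0 u1 (ltW n0); lra.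
have n1 : n <= p' - y.
  by have := hn (t - s) ltac:(lra); lra.
have n2 : n <= p * n - y.
  have : 0 <= (p - t) * n by rewrite mulr_ge0 ?subr_ge0// ltW.
  by have := hn (t - s) ltac:(lra); lra.
have a0 : 0 < p * n - y by lra. have b0 : 0 < p' - y by lra.
have l : ln (p * n - y) + ln (t - s) <= ln (p - s) + ln (p' - y).
  rewrite -!lnM ?posrE// ler_ln ?posrE ?mulr_gt0//.
  have : 0 <= (p - t) * (s * n - y) by rewrite mulr_ge0 ?subr_ge0.
  have : 0 <= (p - s) * (p' - t * n) by rewrite mulr_ge0 ?subr_ge0// -subr_ge0 ltW.
  lra.
have c1 : Cq / (p * n - y) <= Cq / n by rewrite ler_wpM2l// lef_pV2 ?posrE.
have c2 : Cq / (p' - y) <= Cq / n by rewrite ler_wpM2l// lef_pV2 ?posrE.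
have := q_le g2; have := q_ge g1; have := ler_wpM2l t2 l.
lra.
Qed.

Lemma shelve_near (p y p' y' : R) : 0 <= y -> theta <= p - y -> theta <= p' - y' ->
  q (p - y) <= q (p' - y') + (2 * theta * ln p + (2 * (Cq / theta) + 2 * theta * `|ln theta|)).
Proof.
move=> y0 g1 g2.
have t2 : 0 <= 2 * theta by rewrite mulr_ge0// ltW.
have a0 : 0 < p - y by exact: lt_le_trans g1.
have b0 : 0 < p' - y' by exact: lt_le_trans g2.
have l1 : ln (p - y) <= ln p by rewrite ler_ln ?posrE//; lra.
have l2 : ln theta <= ln (p' - y') by rewrite ler_ln ?posrE.
have c1 : Cq / (p - y) <= Cq / theta by rewrite ler_wpM2l// lef_pV2 ?posrE.
have c2 : Cq / (p' - y') <= Cq / theta by rewrite ler_wpM2l// lef_pV2 ?posrE.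
have l3 := ler_norm (- ln theta); rewrite normrN in l3.
have := q_le g1; have := q_ge g2; have := ler_wpM2l t2 l1.
have := ler_wpM2l t2 l2; have := ler_wpM2l t2 l3.
lra.
Qed.

(** The interaction of a moved particle with the bulk below T0 N is controlled by
    [shelve_far].  There are only [n0] other particles, so that the crude bound
    [shelve_near] suffices for them. *)
Lemma shelve_pairs lam (T0 T1 : R) n0 k : noninc N lam ->
  1 <= T0 -> theta <= T1 -> 1 <= T1 - T0 -> (k <= n0)%N -> (n0 <= N)%N ->
  (forall i, (i < k)%N -> T1 * N%:R <= pos theta N lam i) ->
  (forall i, (k <= i)%N -> (i < N)%N -> pos theta N lam i < T1 * N%:R) ->
  (forall i, (n0 <= i)%N -> (i < N)%N -> pos theta N lam i < T0 * N%:R) ->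
  pairs theta N q lam <= pairs theta N q (shelve T1 k lam)
   + \sum_(0 <= a < k) (2 * theta * N%:R * (ln (pos theta N lam a / N%:R - T0) - ln (T1 - T0))
       + 2 * Cq + n0%:R * (2 * theta * ln (pos theta N lam a) + (2 * (Cq / theta) + 2 * theta *
           `|ln theta|))).
Proof.
move=> h T0_ge1 tT1 T10 kn0 n0N hk1 hk2 hn0.
have kN := leq_trans kn0 n0N.
have h' := shelve_noninc kN h hk2 tT1.
rewrite /pairs (@big_cat_nat _ _ _ k)//=.
rewrite [X in _ <= X + _](@big_cat_nat _ _ _ k)//=.
rewrite addrAC.
have -> : \sum_(k <= i < N) \sum_(i.+1 <= j < N) q (pos theta N lam i - pos theta N lam j)
  = \sum_(k <= i < N) \sum_(i.+1 <= j < N) q (pos theta N (shelve T1 k lam) i - pos theta N (shelve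
      T1 k lam) j).
  apply: eq_big_nat => i /andP[ki iN]; apply: eq_big_nat => j /andP[ij jN].
  by rewrite !pos_shelve_ge//; lia.
rewrite lerD2r -big_split/=; apply: ler_sum_nat => a /andP[_ ak].
have an0 : (a < n0)%N by exact: leq_trans kn0.
have n_gt0 : 0 < (N%:R : R) by rewrite ltr0n.
have pa := hk1 a ak.
have xa : T1 <= pos theta N lam a / N%:R by rewrite ler_pdivlMr.
have xpos : pos theta N lam a / N%:R * N%:R = pos theta N lam a by rewrite divfK ?gt_eqF.
have /andP[pa' _] := pos_shelve lam tT1 kN ak.
rewrite (@big_cat_nat _ _ _ n0)//= [X in _ <= X + _](@big_cat_nat _ _ _ n0)//=.
set c1 := 2 * theta * ln (pos theta N lam a) + _.
set r := ln _ - ln _.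
have c1_ge0 : 0 <= c1.
  rewrite /c1 !addr_ge0 ?mulr_ge0 ?invr_ge0 ?(ltW theta_gt0)//.
  apply: ln_ge0; apply: le_trans pa; rewrite mulr_ege1//; last by rewrite ler1n.
  lra.
have r_ge0 : 0 <= r.
  by rewrite /r subr_ge0 ler_ln ?posrE; lra.
have near : \sum_(a.+1 <= j < n0) q (pos theta N lam a - pos theta N lam j) <=
   \sum_(a.+1 <= j < n0) q (pos theta N (shelve T1 k lam) a - pos theta N (shelve T1 k lam) j) +
       n0%:R * c1.
  rewrite -lerBlDl -sumrB.
  apply: (@le_trans _ _ ((n0 - a.+1)%:R * c1)); last first.
    by apply: ler_wpM2r => //; rewrite ler_nat leq_subr.
  apply: sum_const_le => // j /andP[aj jn0].
  have jN : (j < N)%N by exact: leq_trans n0N.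
  rewrite lerBlDl.
  apply: shelve_near; first exact: pos_ge0.
    exact: pos_gap_theta.
  exact: pos_gap_theta.
have far : \sum_(n0 <= j < N) q (pos theta N lam a - pos theta N lam j) <=
   \sum_(n0 <= j < N) q (pos theta N (shelve T1 k lam) a - pos theta N (shelve T1 k lam) j)
   + (2 * theta * N%:R * r + 2 * Cq).
  have -> : 2 * theta * N%:R * r + 2 * Cq = N%:R * (2 * theta * r + 2 * Cq / N%:R).
    by field; rewrite gt_eqF.
  rewrite -lerBlDl -sumrB.
  apply: (@le_trans _ _ ((N - n0)%:R * (2 * theta * r + 2 * Cq / N%:R))); last first.
    apply: ler_wpM2r; last by rewrite ler_nat leq_subr.
    by rewrite addr_ge0// !mulr_ge0 ?invr_ge0// ltW.
  apply: sum_const_le => // j /andP[nj jN].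
  have aj : (a < j)%N by exact: leq_trans nj.
  have kj : (k <= j)%N by exact: leq_trans nj.
  rewrite lerBlDl (pos_shelve_ge T1 lam kj) -{1}xpos.
  apply: shelve_far => //; first exact/ltW/hn0.
    by rewrite -(pos_shelve_ge T1 lam kj); exact: pos_gap_theta.
  by rewrite xpos; exact: pos_gap_theta.
move: near far; move: (\sum_(a.+1 <= j < n0) _) (\sum_(n0 <= j < N) _) (\sum_(a.+1 <= j < n0) _)
    (\sum_(n0 <= j < N) _).
move=> s1 s2 s3 s4; lra.
Qed.

Lemma shelve_pot (W : R -> R) lam (T1 : R) k : (k <= N)%N ->
  pot theta N W (shelve T1 k lam) = pot theta N W lam
   + \sum_(0 <= a < k) (N%:R * W (pos theta N (shelve T1 k lam) a / N%:R) - N%:R * W (pos theta N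
       lam a / N%:R)).
Proof.
move=> kN; rewrite /pot (@big_cat_nat _ _ _ k)//= [X in _ = X + _](@big_cat_nat _ _ _ k)//=.
rewrite sumrB.
have -> : \sum_(k <= i < N) N%:R * W (pos theta N (shelve T1 k lam) i / N%:R) = \sum_(k <= i < N)
    N%:R * W (pos theta N lam i / N%:R).
  by apply: eq_big_nat => i /andP[ki _]; rewrite pos_shelve_ge.
ring.
Qed.

End Shelve.

(** * The entropy of the comparison *)

Section Penalty.
Context {R : realType}.
Variables (theta : R) (N : nat).
Hypothesis theta_gt0 : 0 < theta.
Hypothesis N_gt0 : (0 < N)%N.

Definition step lam i : nat := (lam i - (if (i.+1 < N)%N then lam i.+1 else 0))%N.

Definition penalty lam : R := \sum_(0 <= i < N) ln (((step lam i).+1 * (step lam i).+2)%:R : R).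

Lemma ln_step_le (m : nat) : ln ((m.+1 * m.+2)%:R : R) <= 2 * m%:R + 1.
Proof.
have m0 : 0 <= (m%:R : R) by [].
rewrite natrM lnM ?posrE ?ltr0n// -natr1 -[m.+2%:R]natr1 -[m.+1%:R]natr1.
have := @le_ln1Dx R m%:R; have := @le_ln1Dx R (m%:R + 1).
rewrite [1 + _]addrC [1 + m%:R]addrC => /(_ ltac:(lra)) h1 /(_ ltac:(lra)) h2.
lra.
Qed.

Lemma sum_step lam k : noninc N lam -> (k < N)%N ->
  \sum_(k <= i < N) ((step lam i)%:R : R) = (lam k)%:R.
Proof.
move=> h kN.
pose f i : R := if (i < N)%N then (lam i)%:R else 0.
transitivity (\sum_(k <= i < N) (f i - f i.+1)).
  apply: eq_big_nat => i /andP[ki iN]; rewrite /step /f iN.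
  case: ifP => iN'; last by rewrite subr0 subn0.
  by rewrite natrB//; apply: h.
under eq_bigr do rewrite -opprB.
rewrite sumrN telescope_sumr; last exact: ltnW.
by rewrite /f ltnn kN sub0r opprK.
Qed.

(** Each of the k distant particles pays its own logarithm.  The remaining differences
    telescope to at most T N. *)
Lemma penalty_le lam (T : R) k : noninc N lam -> (k <= N)%N -> 0 <= T ->
  (forall i, (i < k)%N -> N%:R <= pos theta N lam i) ->
  (forall i, (k <= i)%N -> (i < N)%N -> pos theta N lam i < T * N%:R) ->
  penalty lam <= 2 * \sum_(0 <= a < k) ln (pos theta N lam a / N%:R)
     + k%:R * (4 + 2 * ln N%:R) + (2 * T + 1) * N%:R.
Proof.
move=> h kN T0 hk1 hk2.
have n0 : 0 < (N%:R : R) by rewrite ltr0n.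
rewrite /penalty (@big_cat_nat _ _ _ k)//=; apply: lerD.
  have -> : 2 * \sum_(0 <= a < k) ln (pos theta N lam a / N%:R) + k%:R * (4 + 2 * ln N%:R)
    = \sum_(0 <= a < k) (2 * ln (pos theta N lam a / N%:R) + (4 + 2 * ln N%:R)).
    by rewrite mulr_sumr big_split/= sumr_const_nat subn0 -[(4 + _) *+ k]mulr_natl.
  apply: ler_sum_nat => a /andP[_ ak].
  have pa := hk1 a ak.
  have p0 : 0 < pos theta N lam a by exact: lt_le_trans pa.
  have p1 : 1 <= pos theta N lam a by apply: le_trans pa; rewrite ler1n.
  have sp : ((step lam a)%:R : R) <= pos theta N lam a.
    apply: (@le_trans _ _ (lam a)%:R); first by rewrite ler_nat leq_subr.
    by rewrite /pos lerDl mulr_ge0// ltW.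
  rewrite ln_div ?posrE//.
  apply: (@le_trans _ _ (ln ((3 * pos theta N lam a) * (3 * pos theta N lam a)))).
    rewrite ler_ln ?posrE ?ltr0n ?muln_gt0 ?mulr_gt0// natrM.
    by apply: ler_pM => //; rewrite -natr1 -?[in X in X + 1 <= _]natr1; lra.
  rewrite !lnM ?posrE ?mulr_gt0//.
  have := @le_ln1Dx R 2 ltac:(lra); have -> : 1 + 2 = 3 :> R by ring.
  lra.
apply: (@le_trans _ _ (\sum_(k <= i < N) (2 * (step lam i)%:R + 1))).
  by apply: ler_sum_nat => i _; exact: ln_step_le.
rewrite big_split/= -mulr_sumr sumr_const_nat.
have : ((N - k)%:R : R) <= N%:R by rewrite ler_nat leq_subr.
have [kN'|kN'] := ltnP k N; last first.
  rewrite big_geq// mulr0 add0r => hN; apply: (le_trans hN); rewrite ler_peMl ?(ltW n0)//; lra.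
rewrite sum_step//.
have := hk2 k (leqnn _) kN'; have : (lam k)%:R <= pos theta N lam k.
  by rewrite /pos lerDl mulr_ge0// ltW.
lra.
Qed.

End Penalty.

(** * The downhill map *)

(** Comparison of powers of nu with n = nu^20: the main term k n is at least nu^28, the
    losses independent of k are at most of order nu^25, and the logarithmic losses of the
    k particles are negligible against k n. *)
Lemma thick_arith (R : realType) (nu n l k S c K L T lT xt A G FR : R) :
  88 <= nu -> 2 * (A + (2 * T + 1) + L + 21 * K + 2 * FR) <= nu -> 2 <= xt * nu ->
  n = nu ^+ 20 -> 0 <= l -> l <= 20 * nu -> nu ^+ 8 <= k -> k * lT <= S ->
  xt * lT = c + 1 -> 0 <= lT -> 0 <= K -> 0 <= A -> 0 <= L -> 0 <= T -> 0 <= FR ->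
  G * n <= FR * nu ^+ 5 ->
  A * n + (2 * S + k * (4 + 2 * l) + (2 * T + 1) * n) + K * (n * (1 + l))
    + 2 * G * n ^+ 2 + L * n + c * (k * n) <= 2 * (xt * n * S).
Proof.
move=> nu88 nuC xn nE l0 l1 nuk S1 xtl lT0 K0 A0 L0 T0 FR0 GE.
have nu1 : 1 <= nu by lra.
have nu0 : 0 <= nu by lra.
have pw a b : (a <= b)%N -> nu ^+ a <= nu ^+ b by move=> ac; apply: ler_weXn2l.
have nnu : nu <= n by rewrite nE -[leLHS]expr1 pw.
have n0 : 0 <= n by lra.
have k0 : 0 <= k by apply: le_trans nuk; rewrite exprn_ge0.
have xt0 : 0 <= xt.
  rewrite leNgt; apply/negP => h; have := mulr_le0_ge0 (ltW h) nu0; lra.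
have S0 : 0 <= S by apply: le_trans S1; rewrite mulr_ge0.
have E1 : n * k * (c + 1) <= xt * n * S.
  have := ler_wpM2l (mulr_ge0 xt0 n0) S1.
  by rewrite -xtl; lra.
have E2 : 2 * S <= xt * n * S.
  by rewrite ler_wpM2r//; apply: (le_trans xn); rewrite ler_wpM2l.
have E3 : k * (4 + 2 * l) <= k * (n / 2).
  rewrite ler_wpM2l//.
  have h2 : nu ^+ 2 <= n by rewrite nE pw.
  have : 88 * nu <= nu ^+ 2 by rewrite expr2 ler_wpM2r//; lra.
  lra.
have n25 : n <= nu ^+ 25 by rewrite nE pw.
have E4 : n * (1 + l) <= 21 * nu ^+ 25.
  apply: (@le_trans _ _ (n * (21 * nu))).
    by rewrite ler_wpM2l//; lra.
  have -> : n * (21 * nu) = 21 * nu ^+ 21 by rewrite nE; ring.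
  by rewrite ler_wpM2l// pw.
have E5 : G * n ^+ 2 <= FR * nu ^+ 25.
  have := ler_wpM2r n0 GE.
  have -> : FR * nu ^+ 5 * n = FR * nu ^+ 25 by rewrite nE; ring.
  by rewrite expr2 mulrA.
set Ct := A + _ + _ + _ + _ in nuC.
have E6 : Ct * nu ^+ 25 <= k * n / 2.
  have : nu ^+ 8 * n <= k * n by rewrite ler_wpM2r.
  have -> : nu ^+ 8 * n = nu ^+ 3 * nu ^+ 25 by rewrite nE; ring.
  have n3 : nu <= nu ^+ 3 by rewrite -[leLHS]expr1 pw.
  have : 2 * Ct * nu ^+ 25 <= nu ^+ 3 * nu ^+ 25.
    by rewrite ler_wpM2r ?exprn_ge0//; lra.
  lra.
have E7 : A * n + (2 * T + 1) * n + K * (n * (1 + l)) + 2 * G * n ^+ 2 + L * n <= Ct * nu ^+ 25.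
  have a1 := ler_wpM2l A0 n25.
  have t1 : 0 <= 2 * T + 1 by lra.
  have a2 := ler_wpM2l t1 n25.
  have a3 := ler_wpM2l K0 E4.
  have a4 := ler_wpM2l L0 n25.
  by rewrite /Ct; lra.
lra.
Qed.

Lemma shelve_arith_common (R : realType) (th Cq c3 nu l n0 lx : R) :
  0 <= th -> 0 <= Cq -> 0 <= c3 -> 1 <= nu -> l <= 20 * nu -> 0 <= l ->
  0 <= n0 -> n0 <= nu ^+ 8 ->
  2 * Cq + n0 * (2 * th * (l + lx) + c3) + (2 * lx + (4 + 2 * l)) <=
  (2 * Cq + 40 * th + c3 + 44) * nu ^+ 9 + (2 * th * (n0 * lx) + 2 * lx).
Proof.
move=> th0 Cq0 c30 nu1 l1 l0 n00 n08.
have p9 : 1 <= nu ^+ 9 by exact: exprn_ege1.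
have p89 : nu ^+ 8 <= nu ^+ 9 by exact: ler_weXn2l.
have p19 : nu <= nu ^+ 9 by rewrite -[leLHS]expr1; exact: ler_weXn2l.
have A4 : n0 * l <= 20 * nu ^+ 9.
  apply: (@le_trans _ _ (nu ^+ 8 * (20 * nu))); first by rewrite ler_pM.
  by rewrite le_eqVlt; apply/orP; left; apply/eqP; ring.
have {A4} A4 := ler_wpM2l th0 A4.
have A5 : n0 * c3 <= c3 * nu ^+ 9 by rewrite mulrC ler_wpM2l// (le_trans n08).
have A6 := ler_wpM2l Cq0 p9.
move: p89 A4 A5 A6 p9 p19 => _; clear n08; move: (nu ^+ 9) => p; lra.
Qed.

(** Beyond D the surplus xi theta n ln x of the potential over the repulsion pays for
    everything, including the reward n A'. *)
Lemma shelve_arith_far (R : realType) (th xt Cq c3 M A' V1 nu n l n0 lx g w w' : R) :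
  0 <= th -> 0 <= xt -> 0 <= Cq -> 0 <= c3 -> 1 <= nu -> nu ^+ 9 <= n ->
  0 <= l -> l <= 20 * nu -> 0 <= n0 -> n0 <= nu ^+ 8 -> 0 <= lx -> g <= lx ->
  `|V1| + A' <= xt * lx -> 2 * (th + xt) * lx <= w -> n * w' <= n * V1 + M * nu ^+ 9 ->
  2 * th + 2 <= xt * nu ->
  2 * th * n * g + 2 * Cq + n0 * (2 * th * (l + lx) + c3) + (n * w' - n * w)
    + (2 * lx + (4 + 2 * l)) <=
  (2 * Cq + 40 * th + c3 + 44 + M) * nu ^+ 9 - n * A'.
Proof.
move=> th0 xt0 Cq0 c30 nu1 nun l0 l1 n00 n08 lx0 gx V1x wx w'x xnu.
have com := shelve_arith_common lx th0 Cq0 c30 nu1 l1 l0 n00 n08.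
have p9 : 1 <= nu ^+ 9 by exact: exprn_ege1.
have p8 : 1 <= nu ^+ 8 by exact: exprn_ege1.
have n_ge0 : 0 <= n by apply: le_trans nun; apply: le_trans p9.
have thn : 0 <= 2 * th * n by rewrite !mulr_ge0.
have r1 := ler_wpM2l thn gx.
have {}wx := ler_wpM2l n_ge0 wx.
have B1 := ler_wpM2l n_ge0 V1x.
have B2 : n * V1 <= n * `|V1| by rewrite ler_wpM2l// ler_norm.
have B3 : (2 * th * n0 + 2) * lx <= n * xt * lx.
  rewrite ler_wpM2r//.
  apply: (@le_trans _ _ ((2 * th + 2) * nu ^+ 8)).
    rewrite (mulrDl (2 * th)); apply: lerD; last by rewrite ler_peMr.
    by apply: ler_wpM2l; rewrite ?mulr_ge0.
  apply: (@le_trans _ _ (xt * nu * nu ^+ 8)).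
    by rewrite ler_wpM2r// (le_trans _ p8).
  by rewrite -mulrA -exprS mulrC ler_wpM2r.
move: com r1 wx B1 B2 B3 w'x; clear; move: (nu ^+ 9) `|V1| => p aV; lra.
Qed.

(** Between T1 and D the minimality of T1, which is the hypothesis
    V1 + 2 th g <= v, cancels the terms of order n. *)
Lemma shelve_arith_near (R : realType) (th Cq c3 M FR V1 nu n l n0 lx lD g e' w w' v : R) :
  0 <= th -> 0 <= Cq -> 0 <= c3 -> 1 <= nu -> 0 <= FR -> 0 <= n ->
  0 <= l -> l <= 20 * nu -> 0 <= n0 -> n0 <= nu ^+ 8 -> 0 <= lx -> lx <= lD ->
  V1 + 2 * th * g <= v -> v - w <= e' -> n * e' <= FR * nu ^+ 9 ->
  n * w' <= n * V1 + M * nu ^+ 9 ->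
  2 * th * n * g + 2 * Cq + n0 * (2 * th * (l + lx) + c3) + (n * w' - n * w)
    + (2 * lx + (4 + 2 * l)) <=
  (2 * Cq + 40 * th + c3 + 44 + M + (2 * th * lD + 2 * lD + FR)) * nu ^+ 9.
Proof.
move=> th0 Cq0 c30 nu1 FR0 n_ge0 l0 l1 n00 n08 lx0 lxD V1v vw e'n w'x.
have com := shelve_arith_common lx th0 Cq0 c30 nu1 l1 l0 n00 n08.
have p9 : 1 <= nu ^+ 9 by exact: exprn_ege1.
have p89 : nu ^+ 8 <= nu ^+ 9 by exact: ler_weXn2l.
have lD0 := le_trans lx0 lxD.
have B1 : n0 * lx <= lD * nu ^+ 9 by rewrite mulrC ler_pM// (le_trans n08).
have {}B1 := ler_wpM2l th0 B1.
have B2 := ler_wpM2l lD0 p9.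
have {}V1v := ler_wpM2l n_ge0 V1v.
have {}vw := ler_wpM2l n_ge0 vw.
move: com B1 B2 V1v vw e'n w'x lxD; clear; move: (nu ^+ 9) => p; lra.
Qed.

Lemma ln_le_ln1Dsqr (R : realType) (c x : R) : 0 <= c -> 1 <= x ->
  2 * c * ln x <= c * ln (1 + x ^+ 2).
Proof.
move=> c0 x1; have x0 : 0 < x := lt_le_trans ltr01 x1.
have -> : 2 * c * ln x = c * ln (x ^+ 2) by rewrite lnXn//; ring.
rewrite ler_wpM2l// ler_ln ?posrE ?exprn_gt0// ?lerDr//.
by rewrite ltr_pwDl// exprn_ge0// ltW.
Qed.

Section Core.
Context {R : realType}.
Variables (theta xi R0 A : R) (F V q : R -> R) (Cq : R).
Hypotheses (theta_gt0 : 0 < theta) (xi_gt0 : 0 < xi) (R0_gt0 : 0 < R0) (A_gt0 : 0 < A).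
Hypothesis F_gt0 : forall a, 0 < a -> 0 < F a.
Hypothesis V_lip : forall a, 0 < a -> exists2 L : R, 0 <= L &
  forall x y, 0 <= x -> x <= y -> y <= a -> `|V y - V x| <= L * (Num.sqrt y - Num.sqrt x).
Hypothesis Cq_ge0 : 0 <= Cq.
Hypothesis hq : forall x : R, theta <= x -> `|q x - 2 * theta * ln x| <= Cq / x.
Implicit Types (lam : nat -> nat) (W : R -> R) (N k : nat).

(** What the argument uses of V_N at a fixed N, with e an upper bound for r_N. *)
Definition admissible W (e : R) :=
  (forall t, 0 <= t -> (1 + xi) * theta * ln (1 + t ^+ 2) <= W t) /\
  (forall a x, 0 < a -> 0 <= x -> x <= a -> `|W x - V x| <= F a * e).

Definition energy N W lam : R := pairs theta N q lam - pot theta N W lam.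

Lemma admissible_ln W e x : admissible W e -> 1 <= x -> 2 * ((1 + xi) * theta) * ln x <= W x.
Proof.
move=> [hW _] x1; apply: le_trans (hW x _); last lra.
have x0 : 0 < x by lra.
by apply: ln_le_ln1Dsqr => //; rewrite mulr_ge0 ?addr_ge0 ?ltW.
Qed.

Lemma ln_pow20 (nu : R) : 1 <= nu -> 0 <= ln (nu ^+ 20) <= 20 * nu.
Proof.
move=> n1; have n0 : 0 < nu by lra.
rewrite ln_ge0 ?exprn_ege1//= lnXn// -[_ *+ 20]mulr_natl ler_wpM2l//.
exact/ltW/ln_sublinear.
Qed.

(** The constants c1 and c2 of the losses of order k N are fixed before T0, which is then
    chosen so that half of the gain, xi theta ln T0 per unit of k N, exceeds their sum by
    one. *)
Lemma thick_tail : exists T0 C : R, [/\ 1 <= T0, 1 <= C &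
  forall (nu : R) N W e lam k, C <= nu -> N%:R = nu ^+ 20 -> admissible W e -> 0 <= e ->
    e * N%:R <= R0 * nu ^+ 5 -> noninc N lam -> (k <= N)%N ->
    (forall i, (i < k)%N -> T0 * N%:R <= pos theta N lam i) ->
    (forall i, (k <= i)%N -> (i < N)%N -> pos theta N lam i < T0 * N%:R) ->
    nu ^+ 8 <= k%:R ->
    energy N W lam + A * N%:R + penalty N lam <= energy N W (refill theta N k lam)].
Proof.
have th0 := theta_gt0; have xi0 := xi_gt0; have R00 := R0_gt0; have A0 := A_gt0; have Cq0 := Cq_ge0.
have [L4 L4_ge0 hL4] := V_lip (mulr_gt0 (ltr0Sn R 3) theta_gt0).
pose M : R := `|V 0| + L4 * Num.sqrt theta + F theta * R0.
pose c1 : R := 2 * (Cq / theta) + 4 * theta + 2 * theta * `|ln theta|.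
pose c2 : R := `|M| + 2 * L4 * Num.sqrt theta.
pose K1 : R := (2 * theta + 2 * Cq) / theta.
have xt : 0 < xi * theta by rewrite mulr_gt0.
have Fth := F_gt0 theta_gt0.
have M0 : 0 <= M.
  by rewrite /M !addr_ge0 ?mulr_ge0 ?sqrtr_ge0// ltW.
have c10 : 0 <= c1 by rewrite /c1 !addr_ge0 ?mulr_ge0 ?invr_ge0 ?(ltW theta_gt0).
have c20 : 0 <= c2 by rewrite /c2 addr_ge0 ?mulr_ge0 ?sqrtr_ge0.
have K10 : 0 <= K1 by rewrite /K1 divr_ge0 ?addr_ge0 ?mulr_ge0 ?(ltW theta_gt0).
(* That is, xi theta ln T0 = c1 + c2 + 1. *)
pose T0 := expR ((c1 + c2 + 1) / (xi * theta)).
have T0_ge1 : 1 <= T0.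
  have c0 : 0 <= c1 + c2 + 1 by lra.
  by rewrite -[leLHS](@expR0 R) /T0 ler_expR divr_ge0// ltW.
have lT0 : xi * theta * ln T0 = c1 + c2 + 1 by rewrite /T0 expRK mulrC divfK ?gt_eqF.
move: T0 T0_ge1 lT0 => T0 T0_ge1 lT0.
have T0t : 0 < T0 + theta := addr_gt0 (lt_le_trans ltr01 T0_ge1) theta_gt0.
have [LT LT_ge0 hLT] := V_lip T0t.
pose L : R := LT / Num.sqrt (2 * theta).
have L0 : 0 <= L by rewrite /L divr_ge0 ?sqrtr_ge0.
have F0 := F_gt0 T0t.
pose Ct : R := A + (2 * T0 + 1) + L + 21 * K1 + 2 * (F (T0 + theta) * R0).
have FR0 : 0 <= F (T0 + theta) * R0 by rewrite mulr_ge0 ?ltW.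
have Ct0 : 0 <= Ct by rewrite /Ct; lra.
exists T0, (88 + 2 / (xi * theta) + 2 * Ct); split => //.
  have : 0 <= 2 / (xi * theta) by rewrite divr_ge0// ltW.
  lra.
move=> nu N W e lam k nuC nE adm e0 eN h kN hk1 hk2 nuk.
have xt2 : 0 <= 2 / (xi * theta) by rewrite divr_ge0// ltW.
have nu88 : 88 <= nu by lra.
have nu1 : 1 <= nu by lra.
have n_gt0 : 0 < (N%:R : R) by rewrite nE exprn_gt0; lra.
have N_gt0 : (0 < N)%N by move: n_gt0; rewrite ltr0n.
have k_gt0 : (0 < k)%N.
  by rewrite -(ltr0n R); apply: lt_le_trans nuk; rewrite exprn_gt0; lra.
have eR : e <= R0.
  rewrite -(ler_pM2r n_gt0); apply: (le_trans eN); rewrite ler_wpM2l ?(ltW R0_gt0)// nE.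
  by apply: ler_weXn2l.
have hN k' : (forall i, (i < k')%N -> T0 * N%:R <= pos theta N lam i) ->
   forall i, (i < k')%N -> N%:R <= pos theta N lam i.
  by move=> H i ik; apply: le_trans (H i ik); rewrite ler_peMl ?(ltW n_gt0).
have P1 := refill_pairs theta_gt0 k_gt0 kN Cq_ge0 hq h (hN k hk1).
have hE x : 0 <= x -> x <= T0 + theta -> `|W x - V x| <= F (T0 + theta) * e.
  by move=> x0 x1; apply: adm.2.
have hM x : 0 <= x -> x <= theta -> W x <= M.
  move=> x0 x1; have := adm.2 theta x theta_gt0 x0 x1; rewrite ler_norml => /andP[_ w1].
  have := hL4 0 x (lexx _) x0 ltac:(lra); rewrite sqrtr0 subr0 ler_norml => /andP[_ w2].
  have w3 := ler_norm (V 0).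
  have w4 : L4 * Num.sqrt x <= L4 * Num.sqrt theta by rewrite ler_wpM2l// ler_wsqrtr.
  have w5 : F theta * e <= F theta * R0 by rewrite ler_wpM2l// ltW.
  by rewrite /M; lra.
pose b : R := 2 * ((1 + xi) * theta).
have b0 : 0 <= b by rewrite /b !mulr_ge0 ?addr_ge0 ?ltW.
have P2 := refill_pot theta_gt0 k_gt0 kN T0_ge1 L4_ge0 LT_ge0 hL4 hLT hE hM b0
  (fun x => @admissible_ln W e x adm) hk1 hk2.
have P3 := penalty_le theta_gt0 N_gt0 h kN (le_trans ler01 T0_ge1) (hN k hk1) hk2.
have S1 : k%:R * ln T0 <= \sum_(0 <= a < k) ln (pos theta N lam a / N%:R).
  have -> : k%:R * ln T0 = \sum_(0 <= a < k) ln T0 by rewrite sumr_const_nat subn0 mulr_natl.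
  apply: ler_sum_nat => a /andP[_ ak].
  have xa : T0 <= pos theta N lam a / N%:R by rewrite ler_pdivlMr// hk1.
  have T0_gt0 : 0 < T0 := lt_le_trans ltr01 T0_ge1.
  by rewrite ler_ln ?posrE// (lt_le_trans T0_gt0).
have := ln_pow20 nu1; rewrite -nE => /andP[ln0 ln1].
move: P1 P2 P3 S1; rewrite -/c1 -/c2 -/K1 -/L /energy.
rewrite ger0_norm; last by rewrite mulr_ge0// ltW.
move: (pairs _ _ _ _) (pairs _ _ _ _) (pot _ _ _ _) (pot _ _ _ _) (penalty _ _) (\sum_(_ <= _ < _)
    _).
move=> p1 p2 u1 u2 pen S P1 P2 P3 S1.
have xn : 2 <= xi * theta * nu.
  by rewrite -ler_pdivrMl// mulrC; lra.
have GE : F (T0 + theta) * e * N%:R <= F (T0 + theta) * R0 * nu ^+ 5.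
  by rewrite -!mulrA ler_wpM2l ?(ltW F0).
have arith := @thick_arith R nu N%:R (ln N%:R) k%:R S (c1 + c2) K1 L T0 (ln T0) (xi * theta) A
  (F (T0 + theta) * e) (F (T0 + theta) * R0).
move: P1 P2 P3 S1 arith.
rewrite /b; move: (ln (N%:R : R)) (N%:R : R) (k%:R : R) nE nuk ln0 ln1 GE => l n kR nE nuk ln0 ln1
    GE P1 P2 P3 S1.
move=> /(_ nu88 _ xn nE ln0 ln1 nuk S1 lT0 (ln_ge0 T0_ge1) K10 (ltW A0) L0 (le_trans ler01 T0_ge1)
    FR0 GE).
have nuCt : 2 * Ct <= nu by move: xt2; move: nuC; move: (2 / _) => *; lra.
move=> /(_ nuCt); move: P1 P2 P3; clearbody c1 c2 K1; lra.
Qed.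

Hypothesis V_derivable : forall x, 0 < x -> derivable V x 1.
Hypothesis V_low : forall t, 0 <= t -> (1 + xi) * theta * ln (1 + t ^+ 2) <= V t.

Lemma V_low_ln x : 1 <= x -> 2 * ((1 + xi) * theta) * ln x <= V x.
Proof.
move=> x1; have x0 : 0 < x by lra.
apply: le_trans (V_low (ltW x0)).
by apply: ln_le_ln1Dsqr => //; rewrite mulr_ge0 ?addr_ge0 ?ltW.
Qed.

(** V(t) - 2 theta ln (t - T0) tends to infinity because V grows faster than
    2 theta ln t, hence it attains its minimum on the half-line. *)
Lemma best_shelf (T0 s : R) : 1 <= T0 -> T0 + 1 <= s -> exists2 T1 : R, s <= T1 &
  forall t, T1 <= t -> V T1 + 2 * theta * (ln (t - T0) - ln (T1 - T0)) <= V t.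
Proof.
move=> T0_ge1 T0s; have th0 := theta_gt0; have xi0 := xi_gt0.
pose g t : R := V t - 2 * theta * ln (t - T0).
have xt : 0 < 2 * (xi * theta) by rewrite !mulr_gt0.
(* Beyond M the growth of V gives g t >= 2 xi theta ln t >= g s, so that it suffices to
   minimize g on [s, M]. *)
pose M : R := s + expR (`|g s| / (2 * (xi * theta))).
have sM : s <= M by rewrite /M lerDl expR_ge0.
have gM t : M <= t -> g s <= g t.
  move=> Mt; have e0 := expR_gt0 (`|g s| / (2 * (xi * theta))).
  have t1 : 1 <= t by move: Mt; rewrite /M; lra.
  have t0 : 0 < t - T0 by move: Mt; rewrite /M; lra.
  have h1 : 2 * (xi * theta) * ln t >= `|g s|.
    rewrite -ler_pdivrMl// mulrC -[leLHS](@expRK R) ler_ln ?posrE ?expR_gt0//; last lra.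
    by move: Mt; rewrite /M; lra.
  have h2 : ln (t - T0) <= ln t by rewrite ler_ln ?posrE//; lra.
  have t2 : 0 <= 2 * theta by lra.
  have := ler_wpM2l t2 h2; have := V_low_ln t1; have := ler_norm (g s).
  have -> : g t = V t - 2 * theta * ln (t - T0) by [].
  by move: h1; move: (g s) => gs; lra.
have cg : {within `[s, M], continuous g}.
  apply: derivable_within_continuous => t; rewrite in_itv/= => /andP[st _].
  have t0 : 0 < t by lra.
  have t1 : 0 < t - T0 by lra.
  have d1 : derivable (fun t => ln (t - T0)) t 1.
    have := @is_derive1_comp R (@exp.ln R) (fun t => t - T0) t (t - T0)^-1 1.
    have s1 : is_derive t 1 (fun t : R => t - T0) 1.
      have := is_deriveB (is_derive_id t (1 : R)) (is_derive_cst T0 t (1 : R)).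
      by rewrite subr0.
    by move=> /(_ (is_derive1_ln t1) s1) [].
  apply: (@derivableB _ _ _ V (fun t => 2 * theta * ln (t - T0))); first exact: V_derivable.
  exact: (derivableM (derivable_cst (2 * theta) t 1) d1).
have [T1 T1in T1min] := EVT_min sM cg.
move: T1in; rewrite in_itv/= => /andP[sT1 T1M].
exists T1 => // t T1t.
suff : g T1 <= g t by rewrite /g; lra.
have [tM|Mt] := leP t M.
  by apply: T1min; rewrite in_itv/= tM (le_trans sT1).
apply: le_trans (gM t (ltW Mt)); apply: T1min.
by rewrite in_itv/= lexx sM.
Qed.

(** The moved particles end at distance O(k / N) from T1, so that replacing V_N by V and
    then x by T1 costs O(e n + k). *)
Lemma shelf_potential (T1 : R) : 1 <= T1 -> exists2 M : R, 0 <= M &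
  forall (nu n kR x e : R) W, 1 <= nu -> n = nu ^+ 20 -> admissible W e ->
    e * n <= R0 * nu ^+ 5 -> 0 <= kR -> kR <= nu ^+ 8 -> kR <= n ->
    T1 <= x -> x * n <= T1 * n + kR * theta + theta + 1 ->
    n * W x <= n * V T1 + M * nu ^+ 9.
Proof.
move=> T1_ge1; have th0 := theta_gt0; have R00 := R0_gt0.
pose a := T1 + 2 * theta + 1.
have a0 : 0 < a by rewrite /a; lra.
have [L L0 hL] := V_lip a0.
have Fa := F_gt0 a0.
have t1 : 0 <= 2 * theta + 1 by lra.
exists (F a * R0 + L * (2 * theta + 1)).
  by rewrite addr_ge0 ?mulr_ge0// ltW.
move=> nu n kR x e W nu1 nE adm eN k0 k8 kn T1x xn.
have n1 : 1 <= n by rewrite nE exprn_ege1.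
have n_gt0 : 0 < n := lt_le_trans ltr01 n1.
have xa : x <= a.
  rewrite -(ler_pM2r n_gt0); apply: (le_trans xn).
  have := ler_wpM2r (ltW th0) kn; have := ler_wpM2r (ltW th0) n1.
  by rewrite /a; lra.
have T10 : 0 <= T1 := le_trans ler01 T1_ge1.
have := adm.2 _ _ a0 (le_trans T10 T1x) xa; rewrite ler_norml => /andP[_ w1].
have := hL T1 x T10 T1x xa; rewrite ler_norml => /andP[_ w2].
have w3 := @sqrtrB_le R T1 x (lt_le_trans ltr01 T1_ge1) T1x.
have s1 : 1 <= Num.sqrt T1 by rewrite -[leLHS](@sqrtr1 R) ler_wsqrtr.
have w4 : (x - T1) / Num.sqrt T1 <= x - T1.
  by rewrite ler_piMr ?subr_ge0// invf_le1// (lt_le_trans ltr01).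
have w5 := ler_wpM2l L0 (le_trans w3 w4).
have w6 := ler_wpM2l (ltW n_gt0) w1.
have w7 := ler_wpM2l (ltW n_gt0) (le_trans w2 w5).
have w8 : L * ((x - T1) * n) <= L * ((2 * theta + 1) * nu ^+ 8).
  rewrite ler_wpM2l//.
  have p8 : 1 <= nu ^+ 8 by exact: exprn_ege1.
  have := ler_wpM2r (ltW th0) k8; have := ler_wpM2r (ltW th0) p8.
  lra.
have w9 := ler_wpM2l (ltW Fa) eN.
have p59 : nu ^+ 5 <= nu ^+ 9 by exact: ler_weXn2l.
have p89 : nu ^+ 8 <= nu ^+ 9 by exact: ler_weXn2l.
have := ler_wpM2l (mulr_ge0 (ltW Fa) (ltW R00)) p59.
have := ler_wpM2l (mulr_ge0 L0 t1) p89.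
lra.
Qed.

(** The net cost of moving one particle from x to x', its share of the penalty included.
    The minimality of T1 leaves only errors of order nu^9; from D on, the potential wins
    by as much as desired. *)
Lemma shelve_loss (T0 T1 : R) : 1 <= T0 -> T0 + 1 <= T1 ->
  (forall t, T1 <= t -> V T1 + 2 * theta * (ln (t - T0) - ln (T1 - T0)) <= V t) ->
  forall A' : R, 0 <= A' -> exists D C : R, [/\ T1 <= D, 1 <= C &
  forall (nu n l kR n0 x x' e : R) W, C <= nu -> n = nu ^+ 20 -> 0 <= l -> l <= 20 * nu ->
    admissible W e -> e * n <= R0 * nu ^+ 5 ->
    0 <= kR -> kR <= nu ^+ 8 -> kR <= n -> 0 <= n0 -> n0 <= nu ^+ 8 -> T1 <= x -> T1 <= x' ->
    x' * n <= T1 * n + kR * theta + theta + 1 ->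
    2 * theta * n * (ln (x - T0) - ln (T1 - T0)) + 2 * Cq
      + n0 * (2 * theta * (l + ln x) + (2 * (Cq / theta) + 2 * theta * `|ln theta|))
      + (n * W x' - n * W x) + (2 * ln x + (4 + 2 * l))
    <= C * nu ^+ 9 - (if D <= x then n * A' else 0)].
Proof.
move=> T0_ge1 T01 hT1 A' A'0.
have th0 := ltW theta_gt0; have xi0 := xi_gt0.
have T1_ge1 : 1 <= T1 by lra.
have xt : 0 < xi * theta by rewrite mulr_gt0.
(* So that xi theta ln x >= V T1 + A' for x >= D. *)
pose D : R := T1 + expR ((`|V T1| + A') / (xi * theta)).
have D1 : T1 <= D by rewrite lerDl expR_ge0.
have D0 : 0 < D by apply: lt_le_trans D1; lra.
have DT : `|V T1| + A' <= xi * theta * ln D.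
  rewrite -ler_pdivrMl// mulrC -[leLHS](@expRK R) ler_ln ?posrE ?expR_gt0//.
  by rewrite lerDr; lra.
move: D D1 D0 DT => D D1 D0 DT.
have [M M0 hM] := shelf_potential T1_ge1.
have FDR : 0 <= F D * R0 := ltW (mulr_gt0 (F_gt0 D0) R0_gt0).
pose c3 : R := 2 * (Cq / theta) + 2 * theta * `|ln theta|.
have c30 : 0 <= c3 by rewrite /c3 addr_ge0// !mulr_ge0// invr_ge0.
have lD : 0 <= ln D by apply: ln_ge0; exact: le_trans D1.
pose C2 : R := 2 * Cq + 40 * theta + c3 + 44 + M.
pose C3 : R := 2 * theta * ln D + 2 * ln D + F D * R0.
have C30 : 0 <= C3 by rewrite /C3 addr_ge0// addr_ge0// !mulr_ge0.
have Cq0 := Cq_ge0.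
have C20 : 0 <= C2 by rewrite /C2; lra.
have xt2 : 0 <= (2 * theta + 2) / (xi * theta).
  by rewrite divr_ge0 ?addr_ge0 ?mulr_ge0// ltW.
exists D, (C2 + C3 + (2 * theta + 2) / (xi * theta) + 1); split => //.
  by rewrite lerDr (addr_ge0 (addr_ge0 C20 C30) xt2).
move=> nu n l kR n0 x x' e W nuC nE l0 l1 adm eN k0 k8 kn n00 n08 Tx Tx' hx'.
have [nu1 nux] : 1 <= nu /\ (2 * theta + 2) / (xi * theta) <= nu.
  by move: nuC C20 C30 xt2; move: C2 C3 (_ / _) => *; split; lra.
have nun : nu ^+ 9 <= n by rewrite nE; exact: ler_weXn2l.
have n_ge0 : 0 <= n by apply: le_trans nun; rewrite exprn_ge0// (le_trans ler01).
have x1 := le_trans T1_ge1 Tx.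
have lx0 : 0 <= ln x by exact: ln_ge0.
have gx : ln (x - T0) - ln (T1 - T0) <= ln x.
  have lT : 0 <= ln (T1 - T0) by apply: ln_ge0; rewrite lerBrDl.
  have xT : T0 < x by apply: lt_le_trans Tx; rewrite (lt_le_trans _ T01)// ltrDl.
  have : ln (x - T0) <= ln x.
    by rewrite ler_ln ?posrE ?subr_gt0 ?(lt_le_trans ltr01)// gerBl (le_trans ler01).
  lra.
have p9 : 0 <= nu ^+ 9 by rewrite exprn_ge0// (le_trans ler01).
have Wx' := hM nu n kR x' e W nu1 nE adm eN k0 k8 kn Tx' hx'.
rewrite -/c3; case: ifP => Dx.
  have Wx : 2 * (theta + xi * theta) * ln x <= W x.
    by rewrite -[X in X + _ * _]mul1r -mulrDl; exact: admissible_ln adm x1.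
  have lDx : `|V T1| + A' <= xi * theta * ln x.
    apply: le_trans DT _; rewrite ler_wpM2l ?(ltW xt)// ler_ln ?posrE//.
    exact: lt_le_trans Dx.
  have xnu : 2 * theta + 2 <= xi * theta * nu by rewrite -ler_pdivrMl// mulrC.
  apply: le_trans (shelve_arith_far th0 (ltW xt) Cq_ge0 c30 nu1 nun l0 l1 n00 n08 lx0 gx
    lDx Wx Wx' xnu) _.
  rewrite lerD2r ler_wpM2r//.
  by move: nuC C20 xt2 C30; rewrite -/C2; move: C2 C3 (_ / _) => *; lra.
have xD : x <= D by rewrite ltW// ltNge Dx.
have x0 : 0 < x := lt_le_trans ltr01 x1.
have lxD : ln x <= ln D by rewrite ler_ln.
have := adm.2 D x D0 (ltW x0) xD; rewrite ler_norml => /andP[w1 _].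
have w2 : V x - W x <= F D * e by rewrite -opprB lerNl.
have w3 : n * (F D * e) <= F D * R0 * nu ^+ 9.
  rewrite mulrCA -mulrA ler_wpM2l ?(ltW (F_gt0 D0))// mulrC (le_trans eN)//.
  by rewrite ler_wpM2l ?(ltW R0_gt0)//; exact: ler_weXn2l.
rewrite subr0.
apply: le_trans (shelve_arith_near th0 Cq_ge0 c30 nu1 FDR n_ge0 l0 l1 n00 n08 lx0 lxD
  (hT1 x Tx) w2 w3 Wx') _.
rewrite ler_wpM2r// -/C2 -/C3.
by move: nuC C20 C30 xt2; move: C2 C3 (_ / _) => *; lra.
Qed.

(** At most nu^8 particles are moved, each at a cost O(nu^9), for a total of
    O(nu^17) = o(N); the first of them comes from beyond D and earns the reward. *)
Lemma thin_tail (T0 : R) : 1 <= T0 -> exists D C : R, [/\ 1 <= D, 1 <= C &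
  forall (nu : R) N W e lam n0, C <= nu -> N%:R = nu ^+ 20 -> admissible W e ->
    e * N%:R <= R0 * nu ^+ 5 -> noninc N lam -> (n0 <= N)%N ->
    (forall i, (n0 <= i)%N -> (i < N)%N -> pos theta N lam i < T0 * N%:R) ->
    n0%:R <= nu ^+ 8 -> D * N%:R <= pos theta N lam 0 ->
    exists2 lam', noninc N lam' &
      energy N W lam + A * N%:R + penalty N lam <= energy N W lam'].
Proof.
move=> T0_ge1; have th0 := theta_gt0; have A0 := A_gt0.
have [T1 hT1 T1min] := @best_shelf T0 (T0 + 1 + theta) T0_ge1 ltac:(lra).
have T01 : T0 + 1 <= T1 by lra.
have tT1 : theta <= T1 by lra.
(* The reward A + 2 T1 + 2 per unit of N pays for A, for the part (2 T1 + 1) N of the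
   penalty, and for the accumulated errors, which are at most N. *)
have A'0 : 0 <= A + 2 * T1 + 2 by lra.
have [D [C [D1 C1 hloss]]] := @shelve_loss T0 T1 T0_ge1 T01 T1min _ A'0.
exists D, C; split => //; first by lra.
move=> nu N W e lam n0 nuC nE adm eN h n0N hn0 n08 D0.
have nu1 : 1 <= nu by lra.
have n_gt0 : 0 < (N%:R : R) by rewrite nE exprn_gt0; lra.
have N_gt0 : (0 < N)%N by move: n_gt0; rewrite ltr0n.
have [k [kN hk1 hk2]] := level_count theta_gt0 (T1 * N%:R) h.
have k_gt0 : (0 < k)%N.
  rewrite lt0n; apply/eqP => k0.
  have := hk2 0%N ltac:(by rewrite k0) N_gt0.
  have : T1 * N%:R <= D * N%:R by rewrite ler_wpM2r.
  lra.
have kn0 : (k <= n0)%N.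
  rewrite leqNgt; apply/negP => n0k.
  have := hk1 n0 n0k; have := hn0 n0 (leqnn _) (leq_trans n0k kN).
  have : T0 * N%:R <= T1 * N%:R by rewrite ler_wpM2r//; lra.
  lra.
have hkN i : (i < k)%N -> N%:R <= pos theta N lam i.
  by move=> ik; apply: le_trans (hk1 i ik); rewrite ler_peMl ?(ltW n_gt0)//; lra.
exists (shelve theta N T1 k lam); first exact: shelve_noninc.
have P1 := shelve_pairs theta_gt0 N_gt0 Cq_ge0 hq h T0_ge1 tT1 (_ : 1 <= T1 - T0) kn0 n0N hk1 hk2
    hn0.
have {}P1 := P1 ltac:(lra).
have P2 := shelve_pot theta W lam T1 kN.
have P3 := penalty_le theta_gt0 N_gt0 h kN (_ : 0 <= T1) hkN hk2.
have {}P3 := P3 ltac:(lra).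
set l := ln (N%:R : R) in P3.
have := ln_pow20 nu1; rewrite -nE -/l => /andP[l0 l1].
pose c := 2 * (Cq / theta) + 2 * theta * `|ln theta|.
pose loss a := 2 * theta * N%:R * (ln (pos theta N lam a / N%:R - T0) - ln (T1 - T0)) + 2 * Cq
   + n0%:R * (2 * theta * (l + ln (pos theta N lam a / N%:R)) + c)
   + (N%:R * W (pos theta N (shelve theta N T1 k lam) a / N%:R) - N%:R * W (pos theta N lam a /
       N%:R))
   + (2 * ln (pos theta N lam a / N%:R) + (4 + 2 * l)).
have hl a : (a < k)%N -> loss a <= C * nu ^+ 9 - (if D <= pos theta N lam a / N%:R then N%:R * (A +
    2 * T1 + 2) else 0).
  move=> ak.
  have /andP[p1 p2] := pos_shelve theta_gt0 N_gt0 lam tT1 kN ak.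
  apply: (@hloss nu N%:R l k%:R n0%:R _ _ e W) => //.
  - by apply: le_trans n08; rewrite ler_nat.
  - by rewrite ler_nat.
  - by rewrite ler_pdivlMr// hk1.
  - by rewrite ler_pdivlMr.
  - by rewrite divfK ?gt_eqF.
have hsum : \sum_(0 <= a < k) loss a <= k%:R * (C * nu ^+ 9) - N%:R * (A + 2 * T1 + 2).
  rewrite (big_ltn k_gt0).
  have D0' : D <= pos theta N lam 0 / N%:R by rewrite ler_pdivlMr.
  have := hl 0%N k_gt0; rewrite D0' => l00.
  have : \sum_(1 <= a < k) loss a <= (k - 1)%:R * (C * nu ^+ 9).
    apply: sum_const_le => // a /andP[_ ak]; apply: le_trans (hl a ak) _.
    rewrite gerBl; case: ifP => // _; rewrite mulr_ge0//.
  rewrite natrB//; lra.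
have kC : k%:R * (C * nu ^+ 9) <= N%:R.
  have k8 : (k%:R : R) <= nu ^+ 8 by apply: le_trans n08; rewrite ler_nat.
  apply: (@le_trans _ _ (nu ^+ 8 * (nu * nu ^+ 9))).
    have nu0 : 0 <= nu by lra.
    have C0 : 0 <= C by lra.
    have p9 : 0 <= nu ^+ 9 by exact: exprn_ge0.
    apply: ler_pM => //; first exact: mulr_ge0.
    exact: ler_wpM2r.
  have -> : nu ^+ 8 * (nu * nu ^+ 9) = nu ^+ 18 by ring.
  by rewrite nE; apply: ler_weXn2l.
have E : \sum_(0 <= a < k) loss a =
   \sum_(0 <= a < k) (2 * theta * N%:R * (ln (pos theta N lam a / N%:R - T0) - ln (T1 - T0))
       + 2 * Cq + n0%:R * (2 * theta * ln (pos theta N lam a) + c))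
   + \sum_(0 <= a < k) (N%:R * W (pos theta N (shelve theta N T1 k lam) a / N%:R) - N%:R * W (pos
       theta N lam a / N%:R))
   + (2 * \sum_(0 <= a < k) ln (pos theta N lam a / N%:R) + k%:R * (4 + 2 * l)).
  have -> : k%:R * (4 + 2 * l) = \sum_(0 <= a < k) (4 + 2 * l).
    by rewrite sumr_const_nat subn0 mulr_natl.
  rewrite mulr_sumr -!big_split/=; apply: eq_big_nat => a /andP[_ ak].
  rewrite /loss; congr (_ + _ * (_ * _ + _) + _ + _).
  by rewrite ln_div ?posrE// ?(lt_le_trans n_gt0 (hkN a ak))// /l addrC subrK.
rewrite /energy P2; move: P1; rewrite -/c => P1.
move: E P1 P3 hsum kC.
move: (\sum_(0 <= a < k) loss a) (\sum_(0 <= a < k) (_ + _ + _)) (\sum_(0 <= a < k) (_ - _))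
    (\sum_(0 <= a < k) ln _).
move: (pairs _ _ _ _) (pairs _ _ _ _) (pot _ _ _ _) (penalty _ _) (k%:R * (C * _)) (k%:R * (4 + _)).
move=> z1 z2 z3 z4 z5 z6 y1 y2 y3 y4 E P1 P3 hsum kC.
lra.
Qed.

Lemma downhill : exists D N1 : R, 0 < D /\ forall N W lam, (0 < N)%N -> N1 <= N%:R ->
  admissible W (R0 * N%:R `^ (- (3 / 4))) -> noninc N lam -> D * N%:R <= pos theta N lam 0 ->
  exists2 lam', noninc N lam' &
    energy N W lam + A * N%:R + penalty N lam <= energy N W lam'.
Proof.
have [T0 [C1 [T0_ge1 C1_ge1 thick]]] := thick_tail.
have [D [C2 [D_ge1 C2_ge1 thin]]] := thin_tail T0_ge1.
exists D, ((C1 + C2) ^+ 20); split; first lra.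
move=> N W lam N_gt0 N1 adm h D0.
have n_gt0 : 0 < (N%:R : R) by rewrite ltr0n.
pose nu := (N%:R : R) `^ (20%:R^-1).
have nu0 : 0 <= nu by exact: powR_ge0.
have nuX (m : nat) : nu ^+ m = N%:R `^ (20%:R^-1 * m%:R).
  by rewrite powRrM powR_mulrn.
have nE : N%:R = nu ^+ 20 by rewrite nuX mulVf// powRr1 ?ltW.
have C0 : 0 <= C1 + C2 by lra.
have nuC : C1 + C2 <= nu.
  by rewrite -(@ler_pXn2r _ 20%N) ?nnegrE// -nE.
have e0 : 0 <= R0 * N%:R `^ (- (3 / 4)) by rewrite mulr_ge0 ?powR_ge0 ?ltW.
(* N * N^(-3/4) = N^(1/4) = nu^5 *)
have eN : R0 * N%:R `^ (- (3 / 4)) * N%:R <= R0 * nu ^+ 5.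
  rewrite -mulrA ler_wpM2l ?(ltW R0_gt0)// nuX -[X in _ * X <= _](powRr1 (ltW n_gt0)).
  rewrite -powRD; last by rewrite (gt_eqF n_gt0) implybT.
  rewrite le_eqVlt; apply/orP; left; apply/eqP; congr (_ `^ _).
  by field.
have [k [kN hk1 hk2]] := level_count theta_gt0 (T0 * N%:R) h.
have [k8|k8] := leP (nu ^+ 8) k%:R.
  have k_gt0 : (0 < k)%N.
    rewrite -(ltr0n R); apply: lt_le_trans k8; rewrite exprn_gt0//; lra.
  exists (refill theta N k lam); first exact: refill_noninc.
  by apply: (thick nu N W _ lam k _ nE adm e0 eN h kN hk1 hk2 k8); lra.
by apply: (thin nu N W _ lam k _ nE adm eN h kN hk2 (ltW k8) D0); lra.
Qed.

End Core.

(** * From energies to probabilities *)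

Lemma sum_inv_consecutive (R : realType) M :
  \sum_(0 <= m < M) ((m.+1 * m.+2)%:R : R)^-1 <= 1.
Proof.
have -> : \sum_(0 <= m < M) ((m.+1 * m.+2)%:R : R)^-1 = 1 - (M.+1%:R)^-1.
  elim: M => [|M IH]; first by rewrite big_geq// invr1 subrr.
  rewrite big_nat_recr//= IH natrM.
  have a0 : (M.+1%:R : R) != 0 by rewrite pnatr_eq0.
  have b0 : (M.+2%:R : R) != 0 by rewrite pnatr_eq0.
  have e : (M.+2%:R : R) = M.+1%:R + 1 by rewrite natr1.
  move: a0 b0; rewrite e; move: (M.+1%:R) => u a0 b0.
  by field; rewrite a0 b0.
by rewrite gerBl invr_ge0.
Qed.

Lemma sum_ffun_le1 (R : realType) N M :
  \sum_(f : {ffun 'I_N -> 'I_M}) \prod_(i < N) (((f i).+1 * (f i).+2)%:R : R)^-1 <= 1.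
Proof.
rewrite -(bigA_distr_bigA (fun (i : 'I_N) (m : 'I_M) => ((m.+1 * m.+2)%:R : R)^-1)).
apply: (@le_trans _ _ (\prod_(i < N) 1)); last by rewrite big1.
apply: ler_prod => i _; apply/andP; split.
  by apply: sumr_ge0 => m _; rewrite invr_ge0.
rewrite -(big_mkord xpredT (fun m => ((m.+1 * m.+2)%:R : R)^-1)).
exact: sum_inv_consecutive.
Qed.

Lemma sum_inj_le (R : realType) (T : eqType) (I : finType) (s : seq T) (phi : T -> I) (G : I -> R) :
  uniq s -> {in s &, injective phi} -> (forall i, 0 <= G i) ->
  \sum_(l <- s) G (phi l) <= \sum_i G i.
Proof.
move=> us inj G0.
rewrite -(big_map phi xpredT G) big_uniq ?map_inj_in_uniq//=.
by rewrite [leRHS](bigID [in map phi s])/= lerDl sumr_ge0.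
Qed.

Lemma prod_pairs_nat (R : realType) (G : nat -> nat -> R) N :
  \prod_(i < N) \prod_(j < N | (i < j)%N) G i j =
  \prod_(0 <= i < N) \prod_(i.+1 <= j < N) G i j.
Proof.
rewrite big_mkord; apply: eq_bigr => i _.
by rewrite (@big_nat_widenl _ _ _ i.+1 0)// big_mkord.
Qed.

Section Assembly.
Context {R : realType}.
Variables (theta : R) (N : nat).
Hypothesis theta_gt0 : 0 < theta.
Hypothesis N_gt0 : (0 < N)%N.

Definition partition_of (l : N.-tuple R) (i : nat) : nat :=
  Num.truncn (nth 0 l i - (N - i.+1)%:R * theta).

Lemma partition_ofP l : Wset theta N l ->
  noninc N (partition_of l) /\ (forall i, (i < N)%N -> nth 0 l i = pos theta N (partition_of l) i).
Proof.
move=> [lam [hlam ltnE]].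
have E i (iN : (i < N)%N) : nth 0 l i = (lam (Ordinal iN))%:R + (N - i.+1)%:R * theta.
  by rewrite -(ltnE (Ordinal iN)) (tnth_nth 0).
have P i (iN : (i < N)%N) : partition_of l i = lam (Ordinal iN).
  by apply: truncn_def; rewrite E addrK lexx ltr_nat /=.
split.
  move=> i j ij jN; rewrite (P _ jN) (P _ (leq_ltn_trans ij jN)); exact: hlam.
by move=> i iN; rewrite /pos (P _ iN) E.
Qed.

Definition config_of (lam : nat -> nat) : N.-tuple R := [tuple pos theta N lam i | i < N].

Lemma config_of_Wset lam : noninc N lam -> Wset theta N (config_of lam).
Proof.
move=> h; exists (fun i => lam i); split.
  by move=> i j ij; apply: h.
by move=> i; rewrite tnth_mktuple.
Qed.

Lemma gibbs_weight_energy (W : R -> R) (l : N.-tuple R) lam :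
  (forall x, theta <= x -> 0 < Qtheta theta x) -> noninc N lam ->
  (forall i, (i < N)%N -> nth 0 l i = pos theta N lam i) ->
  gibbs_weight theta W l = expR (energy theta (fun x => ln (Qtheta theta x)) N W lam).
Proof.
move=> Q0 h hl; rewrite /gibbs_weight /energy expRD; congr (_ * _).
  transitivity (\prod_(i < N) \prod_(j < N | (i < j)%N)
                  Qtheta theta (nth 0 l i - nth 0 l j)).
    by apply: eq_bigr => i _; apply: eq_bigr => j _; rewrite !(tnth_nth 0).
  rewrite /pairs expR_sum.
  rewrite (prod_pairs_nat (fun i j => Qtheta theta (nth 0 l i - nth 0 l j))).
  apply: eq_big_nat => i /andP[_ iN]; rewrite expR_sum; apply: eq_big_nat => j /andP[ij jN].
  by rewrite !hl ?(ltn_trans ij)// lnK// posrE; apply: Q0; exact: pos_gap_theta.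
rewrite /pot -sumrN expR_sum.
transitivity (\prod_(i < N) expR (- (N%:R * W (nth 0 l i / N%:R)))).
  by apply: eq_bigr => i _; rewrite (tnth_nth 0).
rewrite -(big_mkord xpredT (fun i => expR (- (N%:R * W (nth 0 l i / N%:R))))).
by apply: eq_big_nat => i /andP[_ iN]; rewrite hl.
Qed.

Lemma penalty_prod lam :
  expR (- penalty N lam) = \prod_(i < N) (((step N lam i).+1 * (step N lam i).+2)%:R : R)^-1.
Proof.
rewrite /penalty -sumrN expR_sum big_mkord; apply: eq_bigr => i _.
by rewrite expRN lnK// posrE ltr0n muln_gt0.
Qed.

Lemma step_inj lam lam' : noninc N lam -> noninc N lam' ->
  (forall i, (i < N)%N -> step N lam i = step N lam' i) ->
  forall i, (i < N)%N -> lam i = lam' i.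
Proof.
move=> h h' E i iN; apply/eqP; rewrite -(eqr_nat R) -(@sum_step R N lam i h iN)
  -(@sum_step R N lam' i h' iN).
by apply/eqP; apply: eq_big_nat => j /andP[_ jN]; rewrite E.
Qed.

Lemma partition_of_inj l l' : Wset theta N l -> Wset theta N l' ->
  (forall i, (i < N)%N -> partition_of l i = partition_of l' i) -> l = l'.
Proof.
move=> /partition_ofP[_ hl] /partition_ofP[_ hl'] E.
apply: eq_from_tnth => i; rewrite !(tnth_nth 0) hl// hl'//.
by rewrite /pos E.
Qed.

(** The sequence of differences determines the partition, and over all sequences with
    entries below M the product of the 1 / ((m + 1) (m + 2)) sums to a product of
    telescoping sums. *)
Lemma penalty_sum_le1 (X : set (N.-tuple R)) : finite_set X -> X `<=` Wset theta N ->
  \sum_(l <- finmap.enum_fset (fset_set X)) expR (- @penalty R N (partition_of l)) <= 1.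
Proof.
move=> finX XW.
have sW l : l \in finmap.enum_fset (fset_set X) -> Wset theta N l.
  by move=> ls; apply: XW; rewrite -inE -in_fset_set.
have : uniq (finmap.enum_fset (fset_set X)) by exact: finmap.fset_uniq.
move: (finmap.enum_fset (fset_set X)) sW => s sW us.
pose M := (\max_(l <- s) \max_(i < N) step N (partition_of l) i).+1.
have stM l i : l \in s -> (i < N)%N -> (step N (partition_of l) i < M)%N.
  move=> ls iN; rewrite ltnS (leq_trans _ (leq_bigmax_seq _ ls isT))//.
  exact: (leq_bigmax (Ordinal iN)).
pose phi (l : N.-tuple R) : {ffun 'I_N -> 'I_M} := [ffun i : 'I_N => inord (step N (partition_of l)
    i)].
have phiE l (i : 'I_N) : l \in s -> phi l i = step N (partition_of l) i :> nat.
  by move=> ls; rewrite ffunE inordK// stM.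
apply: le_trans (@sum_ffun_le1 R N M).
apply: (@le_trans _ _ (\sum_(l <- s) \prod_(i < N) (((phi l i).+1 * (phi l i).+2)%:R : R)^-1)).
  rewrite le_eqVlt; apply/orP; left; apply/eqP; apply: eq_big_seq => l ls.
  by rewrite penalty_prod; apply: eq_bigr => i _; rewrite phiE.
apply: (@sum_inj_le R _ _ s phi (fun f => \prod_(i < N) (((f i).+1 * (f i).+2)%:R : R)^-1)).
- exact: us.
- move=> l l' ls ls' E; apply: partition_of_inj; [exact: sW|exact: sW|].
  have [h _] := partition_ofP (sW l ls); have [h' _] := partition_ofP (sW l' ls').
  apply: step_inj => // i iN.
  by rewrite -(phiE l (Ordinal iN) ls) -(phiE l' (Ordinal iN) ls') E.
- by move=> f; apply: prodr_ge0 => i _; rewrite invr_ge0.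
Qed.

Lemma weight_le_mass (W : R -> R) (l : N.-tuple R) : Wset theta N l ->
  ((gibbs_weight theta W l)%:E <= gibbs_mass theta N W setT)%E.
Proof.
move=> lW; rewrite /gibbs_mass setTI; apply: esum_ge; exists [set l].
  by split; [exact: finite_set1|move=> _ ->].
by rewrite fsbig_set1.
Qed.

Lemma gibbs_mass_le (W : R -> R) (E : set (N.-tuple R)) (c : R) : 0 <= c ->
  (forall l, E l -> Wset theta N l ->
     gibbs_weight theta W l <= c * expR (- @penalty R N (partition_of l))) ->
  (gibbs_mass theta N W E <= c%:E)%E.
Proof.
move=> c0 h; apply: ub_ereal_sup => _ [X [finX XE] <-].
rewrite fsbig_finite//= sumEFin lee_fin.
have XW : X `<=` Wset theta N by move=> l /XE[].
apply: (@le_trans _ _ (c * \sum_(l <- finmap.enum_fset (fset_set X))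
                              expR (- @penalty R N (partition_of l)))).
  rewrite mulr_sumr big_seq [leRHS]big_seq; apply: ler_sum => l ls.
  have /XE[El Wl] : X l by rewrite -inE -in_fset_set.
  exact: h.
by rewrite -[leRHS]mulr1 ler_wpM2l// penalty_sum_le1.
Qed.

End Assembly.

Section Normalization.
Context {R : realType}.
Variables (theta : R) (N : nat).
Hypothesis theta_gt0 : 0 < theta.
Hypothesis N_gt0 : (0 < N)%N.

(** One weight is at most the total mass, and the exponential factors sum to at most one.
    When the total mass is 0 or infinite the measure is the Dirac mass at the zero tuple,
    which lies outside the event. *)
Lemma gibbs_tail_le (W : R -> R) (M c : R) : 0 < M -> 0 <= c ->
  (forall l, Wset theta N l -> M <= nth 0 l 0 ->
     exists2 l', Wset theta N l' &
       gibbs_weight theta W l <=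
       gibbs_weight theta W l' * c * expR (- @penalty R N (partition_of theta l))) ->
  (gibbs theta N W [set l : N.-tuple R | (M <= nth 0 l 0)%R] <= c%:E)%E.
Proof.
move=> M0 c0 h; rewrite /gibbs/= /mnormalize.
set E := [set l : N.-tuple R | _]; set Z := gibbs_mass theta N W setT.
case: ifPn => [_|].
  suff E0 : E [tuple of nseq N 0] -> False.
    apply: (@le_trans _ _ 0%E); last by rewrite lee_fin.
    rewrite le_eqVlt; apply/orP; left; apply/eqP.
    by apply: (etrans (@diracE _ _ _ _ _)); rewrite memNset.
  rewrite /E/= nth_nseq if_same; apply/negP; rewrite -ltNge.
  done.
rewrite negb_or => /andP[Z0 Zoo].
have Zge0 : (0 <= Z)%E by apply: esum_ge0 => l _; rewrite lee_fin gibbs_weight_ge0.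
have Zfin : Z \is a fin_num by rewrite ge0_fin_numE// ltey.
have fZ : 0 < fine Z.
  by rewrite lt_neqAle fine_ge0// andbT eq_sym -(inj_eq (@EFin_inj _)) fineK.
have mE : (gibbs_mass theta N W E <= (fine Z * c)%:E)%E.
  apply: gibbs_mass_le => //; first by rewrite mulr_ge0 ?(ltW fZ).
  move=> l lE lW; have [l' l'W hl] := h _ lW lE.
  apply: (le_trans hl); rewrite !ler_wpM2r ?expR_ge0//.
  by rewrite -lee_fin fineK//; exact: weight_le_mass.
apply: (@le_trans _ _ ((fine Z * c)%:E * ((fine Z)^-1)%:E)%E).
  by rewrite lee_wpmul2r// lee_fin invr_ge0 ltW.
by rewrite -EFinM lee_fin mulrAC divff ?mul1r// gt_eqF.
Qed.

End Normalization.

Lemma measurable_first_coordinate_ge (R : realType) N (M : R) : (0 < N)%N ->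
  measurable [set l : N.-tuple R | M <= nth 0 l 0].
Proof.
move=> N_gt0; rewrite (_ : mkset _ = setT `&` (fun l : N.-tuple R => tnth l (Ordinal N_gt0)) @^-1`
    `[M, +oo[%classic).
  by apply: measurable_tnth.
by apply/seteqP; split => l /=; rewrite in_itv/= andbT (tnth_nth 0)//= => -[].
Qed.

Lemma potential_limit_ge (R : realType) (b V : R) (v r : nat -> R) (F : R) : 0 < F ->
  r @ \oo --> (0 : R) ->
  (forall N, (0 < N)%N -> b <= v N) -> (forall N, (0 < N)%N -> `|v N - V| <= F * r N) ->
  b <= V.
Proof.
move=> F0 r0 hb hv; rewrite leNgt; apply/negP => bV.
have e0 : 0 < (b - V) / F by rewrite divr_gt0// subr_gt0.
have /cvgrPdist_lt/(_ _ e0)[M _ hM] := r0.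
have := hM M.+1 (leqnSn M) => /=; rewrite sub0r normrN => hr.
have := hv M.+1 isT; have := hb M.+1 isT.
have : F * r M.+1 < b - V.
  by rewrite -(ltr_pdivlMl _ _ F0) mulrC (le_lt_trans _ hr)// ler_norm.
move=> h1 h2 /(le_trans (ler_norm _)) h3; lra.
Qed.

Theorem proposition3p4 (R : realType) (theta xi B0 R0 : R) (F1 F2 V : R -> R)
    (theta_gt0 : 0 < theta) (xi_gt0 : 0 < xi) (B0_gt0 : 0 < B0)
    (R0_gt0 : 0 < R0)
    (F1_gt0 : forall a : R, 0 < a -> 0 < F1 a)
    (F1_incr : forall a b : R, 0 < a -> a <= b -> F1 a <= F1 b)
    (F2_gt0 : forall a : R, 0 < a -> 0 < F2 a)
    (F2_incr : forall a b : R, 0 < a -> a <= b -> F2 a <= F2 b)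
    (V_cont : {within `[0, +oo[, continuous V})
    (V_diff : forall x : R, 0 < x -> derivable V x 1)
    (V_deriv : forall a x : R, 0 < a -> 0 < x -> x <= a ->
       `|derive1 V x| <= B0 * (F2 a + `|ln x|)) :
  forall A : R, 0 < A ->
  exists D1 C : R, [/\ 0 < D1, 0 < C &
    forall (VN : nat -> R -> R) (r : nat -> R),
      (forall N : nat, (0 < N)%N -> {within `[0, +oo[, continuous (VN N)}) ->
      (forall (N : nat) (t : R), (0 < N)%N -> 0 <= t ->
         (1 + xi) * theta * ln (1 + t ^+ 2) <= VN N t) ->
      r @ \oo --> (0 : R) ->
      (forall (N : nat) (a : R), (0 < N)%N -> 0 < a ->
         (ereal_sup [set (`|VN N x - V x|%R)%:E | x in `[0%R, a]]
            <= (F1 a * r N)%:E)%E) ->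
      (forall N : nat, (0 < N)%N -> r N <= R0 * N%:R `^ (- (3 / 4))) ->
    forall N : nat, Num.max 2 (theta^-1 * xi^-1) <= N%:R ->
      (gibbs theta N (VN N) [set l : N.-tuple R | (D1 * N%:R <= nth 0 l 0)%R]
         <= (expR (- (A * N%:R) + C))%:E)%E].
Proof.
move=> A A_gt0.
have close VN r N a x :
    (forall (N : nat) (a : R), (0 < N)%N -> 0 < a ->
         (ereal_sup [set (`|VN N x - V x|%R)%:E | x in `[0%R, a]]
            <= (F1 a * r N)%:E)%E) ->
    (0 < N)%N -> 0 < a -> 0 <= x -> x <= a -> `|VN N x - V x| <= F1 a * r N.
  move=> h N0 a0 x0 xa; rewrite -lee_fin; apply: le_trans (h N a N0 a0).
  by apply: ereal_sup_ubound; exists x => //=; rewrite in_itv/= x0 xa.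
(* V is the limit of the V_N and inherits their lower bound.  If V violates it, no V_N
   satisfies the hypotheses and the constants are arbitrary. *)
have [V_low|V_low] := pselect (forall t, 0 <= t -> (1 + xi) * theta * ln (1 + t ^+ 2) <= V t); last first.
  exists 1, 1; split=> // VN r _ VN_low r0 VN_close _; exfalso; apply: V_low => t t0.
  have t1 : 0 < t + 1 by rewrite ltr_wpDl.
  apply: (potential_limit_ge (F1_gt0 _ t1) r0 (v := fun N => VN N t)) => N N0.
    exact: VN_low.
  by apply: close => //; rewrite lerDl.
have [Cq Cq_gt0 hq] := ln_Qtheta theta_gt0.
have [D [N1 [D_gt0 main]]] := @downhill R theta xi R0 A F1 V (fun x => ln (Qtheta theta x)) Cq
  theta_gt0 xi_gt0 R0_gt0 A_gt0 F1_gt0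
  (sqrt_lipschitz B0_gt0 V_cont V_diff V_deriv)
  (ltW Cq_gt0) (fun x hx => (hq x hx).2) V_diff V_low.
exists D, (A * `|N1| + 1); split => //.
  by rewrite ltr_wpDl// mulr_ge0// ltW.
move=> VN r _ VN_low _ VN_close r_le N; rewrite ge_max => /andP[N2 _].
have N_gt0 : (0 < N)%N by rewrite -(ltr_nat R); apply: lt_le_trans N2.
(* Below N1 the bound exceeds one, by the choice of C. *)
have [N1N|NN1] := leP N1 N%:R; last first.
  apply: (le_trans (probability_le1 _ _)).
    by apply: measurable_first_coordinate_ge.
  by rewrite lee_fin -[leLHS]expR0 ler_expR; have := ler_norm N1; nra.
have adm : admissible theta xi F1 V (VN N) (R0 * N%:R `^ (- (3 / 4))).
  split=> [t t0|a x a0 x0 xa]; first exact: VN_low.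
  apply: le_trans (close _ _ _ _ _ VN_close N_gt0 a0 x0 xa) _.
  by rewrite ler_wpM2l ?r_le// ltW// F1_gt0.
apply: (@le_trans _ _ (expR (- (A * N%:R)))%:E); last first.
  by rewrite lee_fin ler_expR lerDl addr_ge0// mulr_ge0// ltW.
have Q_gt0 x : theta <= x -> 0 < Qtheta theta x by move=> /hq[].
apply: gibbs_tail_le => //; first by rewrite mulr_gt0// ltr0n.
move=> l lW; have [h hl] := partition_ofP lW; rewrite hl// => lD.
have [lam' h' hE] := main N (VN N) _ N_gt0 N1N adm h lD.
exists (config_of theta N lam'); first exact: config_of_Wset.
rewrite (gibbs_weight_energy theta_gt0 _ Q_gt0 h hl).
rewrite (gibbs_weight_energy theta_gt0 _ Q_gt0 h'); last first.
  by move=> i iN; rewrite (nth_mktuple _ _ (Ordinal iN)).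
rewrite -!expRD ler_expR; move: hE; set e := energy _ _ _ _ _.
by set e' := energy _ _ _ _ lam'; lra.
Qed.
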